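(* Let $G$ be an abelian group with bounded $p$-torsion and torsion subgroup $T$. Then the following are equivalent: (a) $G$ is balanced-projective; (b) $G$ is a splitting mixed Warfield group; (c) $G\cong T\oplus A$, where $A$ is a completely decomposable torsion-free group.
   Context: All groups are abelian. A group $G$ has bounded $p$-torsion if, for every prime $p$, the $p$-primary component $T_p$ of its torsion subgroup $T$ is bounded (i.e., $p^nT_p=0$ for some $n$ depending on $p$). For a prime $p$ and a group $G$: $p^0G=G$, $p^{\alpha+1}G=p(p^\alpha G)$, $p^\alpha G=\bigcap_{\beta<\alpha}p^\beta G$ for limit ordinals $\alpha$, and $p^\infty G=\bigcap_\alpha p^\alpha G$ (over all ordinals). A generalized height is a formal product $h=\prod_{p\in\mathbb P}p^{v(p)}$, where $\mathbb P$ is the set of primes and each $v(p)$ is an ordinal or the symbol $\infty$; set $h(G)=\bigcap_{p\in\mathbb P}p^{v(p)}G$. A short exact sequence $0\to A\to B\to C\to 0$ is balanced if for every generalized height $h$ the induced sequence $0\to h(A)\to h(B)\to h(C)\to 0$ is exact. A group $P$ is balanced-projective if for every balanced sequence $0\to A\to B\to C\to 0$ the induced map $\mathrm{Hom}(P,B)\to\mathrm{Hom}(P,C)$ is surjective. A group is simply presented if it can be defined by generators and relations in which every relation has the form $px=y$ or $px=0$, where $p$ is a prime and $x,y$ are generators. A Warfield group is a group isomorphic to a direct summand of a simply presented group. A group is splitting mixed if its torsion subgroup is a direct summand. A torsion-free group is completely decomposable if it is a direct sum of groups of torsion-free rank $1$. *)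

(* Defs.v *)
From HB Require Import structures.
From mathcomp Require Import all_boot all_order all_algebra.
From mathcomp Require Import all_classical.
From mathcomp Require Import freeg.

Set Implicit Arguments.
Unset Strict Implicit.
Unset Printing Implicit Defensive.

Import GRing.Theory.

Local Open Scope classical_set_scope.
Local Open Scope card_scope.
Local Open Scope ring_scope.

(* In all this file a group is an abelian group, i.e. a zmodType, and a
   subgroup is a zmodClosed predicate: by classical logic every subset is the
   extension of a boolean predicate. *)

Section Subgroup.
Variables (G : zmodType) (H : zmodClosed G).

Record subgroup : Type := Subgroup { subgroup_val : G ; _ : subgroup_val \in H }.

HB.instance Definition _ := [isSub for subgroup_val].
HB.instance Definition _ := [Choice of subgroup by <:].
HB.instance Definition _ := [SubChoice_isSubZmodule of subgroup by <:].

End Subgroup.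

Definition isomorphic (G H : zmodType) : Prop :=
  exists f : {additive G -> H}, bijective f.

Definition direct_summand (G : zmodType) (H : zmodClosed G) : Prop :=
  exists K : zmodClosed G,
    (forall x, x \in H -> x \in K -> x = 0) /\
    (forall x, exists y z, [/\ y \in H, z \in K & x = y + z]).

(* [G] is the direct sum of the groups [A i], along the injections [inj i]. *)
Definition is_direct_sum (I : choiceType) (A : I -> zmodType) (G : zmodType)
    (inj : forall i, {additive A i -> G}) : Prop :=
  forall x : G, exists! a : forall i, A i,
    finite_set [set i | a i != 0] /\ x = \sum_(i \in [set: I]) inj i (a i).

Section Torsion.
Variable G : zmodType.

Definition torsion : {pred G} :=
  [pred x | `[< exists2 n, (0 < n)%N & x *+ n = 0 >]].

Lemma torsion_zmod_closed : zmod_closed torsion.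
Proof.
split=> [|x y]; first by apply/asboolP; exists 1%N.
move=> /asboolP[m m0 xm] /asboolP[n n0 yn]; apply/asboolP; exists (m * n)%N.
  by rewrite muln_gt0 m0.
by rewrite mulrnBl mulrnA xm mul0rn mulnC mulrnA yn mul0rn subr0.
Qed.

HB.instance Definition _ :=
  GRing.isZmodClosed.Build G torsion torsion_zmod_closed.

Definition torsion_free : Prop :=
  forall (x : G) (n : nat), (0 < n)%N -> x *+ n = 0 -> x = 0.

Definition primary_component (p : nat) : set G :=
  [set x | exists k, x *+ (p ^ k) = 0].

Definition bounded_p_torsion : Prop :=
  forall p, prime p ->
    exists n, forall x, primary_component p x -> x *+ (p ^ n) = 0.

Definition splitting_mixed : Prop := @direct_summand G torsion.

(* Independence in the sense of torsion-free rank: an independent set consists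
   of elements of infinite order. *)
Definition independent (S : set G) : Prop :=
  forall (s : seq G) (c : G -> int), uniq s -> [set` s] `<=` S ->
    \sum_(x <- s) x *~ c x = 0 -> {in s, forall x, c x = 0}.

Definition maximal_independent (S : set G) : Prop :=
  independent S /\ forall S', independent S' -> S `<=` S' -> S' = S.

Definition has_torsion_free_rank (n : nat) : Prop :=
  exists2 S, maximal_independent S & S #= `I_n.

End Torsion.

Arguments torsion : clear implicits.
Arguments has_torsion_free_rank : clear implicits.

(* Only meant for torsion-free groups. *)
Definition completely_decomposable (G : zmodType) : Prop :=
  exists (I : choiceType) (A : I -> zmodType)
         (inj : forall i, {additive A i -> G}),
    (forall i, has_torsion_free_rank (A i) 1) /\ is_direct_sum inj.

(* Ordinals as well-founded trees: [osup F] is the supremum of the family [F].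
   Different trees may denote the same ordinal, and [osup F] is not required to
   be a limit.  Both are harmless below: p^a G decreases with a, so it depends
   only on the ordinal denoted by the tree, and the clause for limit ordinals
   reads as the intersection over a cofinal family, which is also correct for
   any other supremum. *)
Inductive ordinal_tree : Type :=
| ozero
| osucc (a : ordinal_tree)
| osup (I : Type) (F : I -> ordinal_tree).

Fixpoint ppow (G : zmodType) (p : nat) (a : ordinal_tree) : set G :=
  match a with
  | ozero => setT
  | osucc b => [set x *+ p | x in @ppow G p b]
  | osup _ F => [set x | forall i, @ppow G p (F i) x]
  end.
Arguments ppow : clear implicits.

Definition ppow_infty (G : zmodType) (p : nat) : set G :=
  [set x | forall a, ppow G p a x].
Arguments ppow_infty : clear implicits.

(* The chain p^a G becomes stationary within [ordinal_tree].  The proof takes a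
   supremum indexed by G, so the index types allowed in [osup] include the
   carriers of all groups: there are enough ordinals for every group. *)
Lemma ppow_inftyE (G : zmodType) (p : nat) :
  exists a, ppow_infty G p = ppow G p a.
Proof.
have H (x : G) : exists a, ppow G p a x -> ppow_infty G p x.
  have [xp|/existsNP[a nxa]] := pselect (ppow_infty G p x).
    by exists ozero.
  by exists a => /nxa.
have [F HF] := choice H.
exists (osup F); apply/seteqP; split=> x; first by move=> xp i; exact: xp.
by move=> /(_ x); exact: HF.
Qed.

(* [None] stands for the symbol oo; the values at non-primes are ignored. *)
Definition generalized_height : Type := nat -> option ordinal_tree.

Definition height_subgroup (h : generalized_height) (G : zmodType) : set G :=
  [set x | forall p, prime p ->
    if h p is Some a then ppow G p a x else ppow_infty G p x].
Arguments height_subgroup : clear implicits.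

(* Exactness of 0 -> SA -> SB -> SC -> 0 for the restrictions of f and g. *)
Definition short_exact_on (A B C : zmodType)
    (f : {additive A -> B}) (g : {additive B -> C})
    (SA : set A) (SB : set B) (SC : set C) : Prop :=
  [/\ {in SA &, injective f},
      f @` SA = SB `&` [set y | g y = 0] &
      g @` SB = SC].

Definition balanced (A B C : zmodType)
    (f : {additive A -> B}) (g : {additive B -> C}) : Prop :=
  short_exact_on f g setT setT setT /\
  forall h : generalized_height,
    short_exact_on f g (height_subgroup h A) (height_subgroup h B)
      (height_subgroup h C).

Definition balanced_projective (P : zmodType) : Prop :=
  forall (A B C : zmodType) (f : {additive A -> B}) (g : {additive B -> C}),
    balanced f g ->
    forall phi : {additive P -> C}, exists psi : {additive P -> B},
      forall x, g (psi x) = phi x.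

Definition generated (G : zmodType) (S : set G) : set G :=
  [set x | forall H : zmodClosed G, (forall y, S y -> y \in H) -> x \in H].

(* The relators [p x = y], for (p, x, y) in R, and [p x = 0], for (p, x) in
   R0, as elements of the free abelian group on X. *)
Definition relators (X : choiceType) (R : set (nat * X * X))
    (R0 : set (nat * X)) : set {freeg X} :=
  [set w | (exists p x y, R (p, x, y) /\ w = << x >> *+ p - << y >>) \/
           (exists p x, R0 (p, x) /\ w = << x >> *+ p)].

Definition simply_presented (G : zmodType) : Prop :=
  exists (X : choiceType) (R : set (nat * X * X)) (R0 : set (nat * X))
         (pi : {additive {freeg X} -> G}),
    [/\ forall p x y, R (p, x, y) -> prime p,
        forall p x, R0 (p, x) -> prime p,
        forall g, exists w, pi w = g &
        [set w | pi w = 0] = generated (relators R R0)].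

Definition warfield (G : zmodType) : Prop :=
  exists (S : zmodType) (H : zmodClosed S),
    [/\ simply_presented S, direct_summand H & isomorphic G (subgroup H)].

(* Main.v *)
Require Import Defs.
From HB Require Import structures.
From mathcomp Require Import all_boot all_order all_algebra.
From mathcomp Require Import all_classical.
From mathcomp Require Import freeg.
From mathcomp Require Import zify ring.

(** The three conditions are linked in a cycle.

    A short exact sequence from [A] through [B] to [C] is balanced iff each
    element of [C] has a preimage in [B] that is at least as high at every prime,
    and each element of order [p] in [p^a C] lifts to an element of order [p] in
    [p^a B] ([balanced_height_lifting], [balanced_socle_lifting], [balancedP]).

    (c) implies (a).  Homomorphisms are lifted by Zorn's lemma on partial lifts.
    On a torsion group with bounded primary components the partial lifts live
    on pure subgroups, and an element of maximal order modulo a pure subgroup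
    can be adjoined ([torsion_lift]).  On a torsion-free group of rank one they
    must not lower heights, and a quotient by a prime can be adjoined
    ([height_extension]).

    (a) implies (b).  A balanced-projective group [G] is a direct summand of
    every group that is mapped onto it with these two lifting properties.  One
    such group is presented by a symbol [[x]] for each [x] in [G] with the
    relations [p [x] = [p x]]; hence [G] is a Warfield group.  If [G] has bounded
    [p]-torsion, another one is the direct sum of the torsion subgroup of [G]
    and, for each [x] in [G], of the rational group in which [1] has the same
    heights as [x]; hence [G] splits, because this group splits.

    (b) implies (c).  A simply presented group [S] decomposes along the connected
    components of its relations, and each component has torsion-free rank at
    most one, so [S] modulo torsion is completely decomposable
    ([simply_presented_modulo_torsion]).  A torsion-free complement of the torsion
    of [G] is a direct summand of such a quotient, so the Baer-Kulikov-Kaplansky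
    theorem, that direct summands of completely decomposable groups are
    completely decomposable, applies ([completely_decomposable_retract]).

    That theorem is proved for the image of an idempotent endomorphism [pi] of
    [A], the direct sum of groups [A_i] of rank one.  Indices are preordered by
    the existence of nonzero homomorphisms, and the classes of this preorder
    are the types.  In a sum of components of one type, the pure subgroup
    generated by a single element is a direct summand (Baer's lemma,
    [homogeneous_retract]).  An element of the image of [pi] involves finitely
    many types; treating a maximal one of them at a time, the element is
    enclosed in a completely decomposable direct summand of the image
    ([peel_types]).  This suffices when countably many elements have to be
    enclosed ([cd_countable]), and Kaplansky's argument reduces the general case
    to countable pieces ([cd_invariant_extend]). *)

Set Implicit Arguments.
Unset Strict Implicit.
Unset Printing Implicit Defensive.

Import GRing.Theory.

Local Open Scope classical_set_scope.
Local Open Scope card_scope.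
Local Open Scope ring_scope.

(** * Abelian groups *)

Lemma ex_additive (U V : zmodType) (f : U -> V) :
  zmod_morphism f -> exists F : {additive U -> V}, F =1 f.
Proof.
move=> fB; pose F : {additive U -> V} :=
  HB.pack f (GRing.isZmodMorphism.Build U V f fB).
by exists F.
Qed.

Lemma ex_subgroup (G : zmodType) (S : set G) :
  S 0 -> (forall x y, S x -> S y -> S (x - y)) ->
  exists H : zmodClosed G, forall x, (x \in H) = `[< S x >].
Proof.
move=> S0 SB; pose P : {pred G} := [pred x | `[< S x >]].
have cl : zmod_closed P.
  split=> [|x y /asboolP Sx /asboolP Sy]; apply/asboolP => //.
  exact: SB.
pose H : zmodClosed G := HB.pack (P : G -> bool) (GRing.isZmodClosed.Build G P cl).
by exists H.
Qed.

Lemma ex_quotient (G : zmodType) (S : set G) :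
  S 0 -> (forall x y, S x -> S y -> S (x - y)) ->
  exists (Q : zmodType) (q : {additive G -> Q}),
    (forall y, exists x, q x = y) /\ (forall x, q x = 0 <-> S x).
Proof.
move=> S0 SB; have [H HE] := ex_subgroup S0 SB.
have piB : zmod_morphism (\pi_(Quotient.quot H)%qT : G -> Quotient.quot H).
  exact: pi_is_zmod_morphism.
have [q qE] := ex_additive piB.
exists (Quotient.quot H), q; split=> [y|x].
  by exists (repr y); rewrite qE reprK.
have -> : S x <-> x \in H by rewrite HE; split=> [?|/asboolP]; first exact/asboolP.
rewrite -[x in _ <-> x \in _]subr0 Quotient.idealrBE -(raddf0 q) !qE.
by split=> /eqP.
Qed.

Lemma factor_additive (U V W : zmodType) (q : {additive U -> V})
    (f : {additive U -> W}) :
  (forall y, exists x, q x = y) -> (forall x, q x = 0 -> f x = 0) ->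
  exists h : {additive V -> W}, forall x, h (q x) = f x.
Proof.
move=> /choice[s sK] kerq.
have wd x y : q x = q y -> f x = f y.
  by move=> e; apply/subr0_eq; rewrite -raddfB kerq// raddfB e subrr.
have hB : zmod_morphism (f \o s).
  by move=> x y; rewrite /= -raddfB; apply: wd; rewrite raddfB !sK.
have [h hE] := ex_additive hB.
by exists h => x; rewrite hE /=; apply: wd; rewrite sK.
Qed.

(** Zorn's lemma in the form used throughout: chains are taken nonempty,
    because the properties of interest, such as containing [(0, 0)], fail
    for the union of the empty chain. *)
Lemma Zorn_above (T : Type) (P : set (set T)) (A0 : set T) :
  P A0 ->
  (forall F : set (set T), F !=set0 -> F `<=` P -> total_on F subset ->
    P (\bigcup_(X in F) X)) ->
  exists A, [/\ A0 `<=` A, P A & forall B, A `<=` B -> P B -> B `<=` A].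
Proof.
move=> PA0 Pcup; pose P' (A : set T) := P (A0 `|` A).
have [|A [PA maxA]] := @Zorn_bigcup T P'.
  move=> F FP Ftot; rewrite /P'.
  have [->|/set0P[X FX]] := eqVneq F set0; first by rewrite bigcup_set0 setU0.
  have -> : A0 `|` \bigcup_(X in F) X = \bigcup_(Y in setU A0 @` F) Y.
    apply/seteqP; split=> [x [A0x|[Y FY Yx]]|x [_ [Y FY <-]] [A0x|Yx]].
    - by exists (A0 `|` X); [exists X|left].
    - by exists (A0 `|` Y); [exists Y|right].
    - by left.
    - by right; exists Y.
  apply: Pcup => [|_ [Y FY <-]|_ _ [Y FY <-] [Z FZ <-]]; last first.
  - by have [YZ|ZY] := Ftot _ _ FY FZ; [left|right]; apply: setUS.
  - exact: FP.
  - by exists (A0 `|` X); exists X.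
exists (A0 `|` A); split=> // B AB PB.
have A0B : A0 `<=` B by apply: subset_trans AB; apply: subsetUl.
have [BA|nBA] := pselect (B `<=` A); first by apply: subset_trans BA _; apply: subsetUr.
case: (maxA B); first by split=> //; apply: subset_trans AB; apply: subsetUr.
by rewrite /P' (setUidPr _ _).2.
Qed.

Lemma torsion_free_mulz (G : zmodType) (tfG : torsion_free G) (x : G) (m : int) :
  m != 0 -> x *~ m = 0 -> x = 0.
Proof.
case: m => [[|n]|n] // _; first exact: tfG.
by rewrite NegzE mulrNz => /eqP; rewrite oppr_eq0 => /eqP; apply: tfG.
Qed.

Lemma torsion_free_mulzI (G : zmodType) (tfG : torsion_free G) (m : int) :
  m != 0 -> injective (fun x : G => x *~ m).
Proof.
move=> m0 x y /= e; apply/subr0_eq/(torsion_free_mulz tfG m0).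
by rewrite mulrzBl e subrr.
Qed.

(** Bezout's identity on elements: what holds for [x *+ m] and [x *+ n]
    passes to [x] if it is closed under sums and integer multiples. *)
Lemma bezout_split (G : zmodType) (m n : nat) : coprime m n ->
  exists u v : int, forall x : G, x = x *~ u *+ m + x *~ v *+ n.
Proof.
move=> cmn; have /coprimezP[[u v] /= e] : coprimez m n by [].
exists u, v => x.
by rewrite !pmulrn -!mulrzA -mulrzDr e.
Qed.

(** * The transfinite powers of a group *)

Lemma ppow0 (G : zmodType) p a : ppow G p a 0.
Proof.
elim: a => [|a IH|I F IH] //=.
by exists 0; rewrite ?mul0rn.
Qed.

Lemma ppowB (G : zmodType) p a (x y : G) :
  ppow G p a x -> ppow G p a y -> ppow G p a (x - y).
Proof.
elim: a x y => [|a IH|I F IH] x y //=; last by move=> Hx Hy i; apply: IH.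
by move=> [x' Hx <-] [y' Hy <-]; exists (x' - y'); [apply: IH|rewrite mulrnBl].
Qed.

Lemma ppowN (G : zmodType) p a (x : G) : ppow G p a x -> ppow G p a (- x).
Proof. by rewrite -sub0r; apply: ppowB; apply: ppow0. Qed.

Lemma ppowD (G : zmodType) p a (x y : G) :
  ppow G p a x -> ppow G p a y -> ppow G p a (x + y).
Proof. by move=> Hx /ppowN; rewrite -{2}[y]opprK; apply: ppowB. Qed.

Lemma ppowMn (G : zmodType) p a (x : G) n : ppow G p a x -> ppow G p a (x *+ n).
Proof.
move=> Hx; elim: n => [|n IH]; first by rewrite mulr0n; apply: ppow0.
by rewrite mulrS; apply: ppowD.
Qed.

Lemma ppowMz (G : zmodType) p a (x : G) (m : int) :
  ppow G p a x -> ppow G p a (x *~ m).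
Proof.
by case: m => n Hx; [|apply: ppowN]; apply: ppowMn.
Qed.

Lemma ppow_succ (G : zmodType) p a (x : G) : ppow G p (osucc a) x -> ppow G p a x.
Proof. by move=> [y Hy <-]; apply: ppowMn. Qed.

Lemma ppow_hom (G H : zmodType) (f : {additive G -> H}) p a x :
  ppow G p a x -> ppow H p a (f x).
Proof.
elim: a x => [|a IH|I F IH] x //=; last by move=> Hx i; apply: IH.
by move=> [y Hy <-]; exists (f y); [apply: IH|rewrite raddfMn].
Qed.

(** Multiplication by an integer prime to [p] can be undone inside [p^a G],
    even in the presence of torsion, by Bezout's identity. *)
Lemma ppow_coprime (G : zmodType) p a (x : G) m : coprime m p ->
  ppow G p a (x *+ m) -> ppow G p a x.
Proof.
move=> cmp; have [u [v uv]] := bezout_split G cmp.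
elim: a x => [|a IH|I F IH] x //=; last by move=> Hx i; apply: IH.
move=> [y Hy e]; exists (y *~ u + x *~ v); last first.
  rewrite [RHS]uv mulrnDl; congr (_ + _).
  by rewrite [in RHS]pmulrn mulrzAC -pmulrn -e !pmulrn mulrzAC.
apply/ppowD; apply: ppowMz => //.
by apply: IH; rewrite -e; apply: ppowMn.
Qed.

Definition onat n := iter n osucc ozero.

Lemma ppow_onatP (G : zmodType) p n (x : G) :
  ppow G p (onat n) x <-> exists y, x = y *+ p ^ n.
Proof.
elim: n x => [|n IH] x /=; first by split=> // _; exists x.
split=> [[y /IH[z ->] <-]|[z ->]].
  by exists z; rewrite -mulrnA expnSr.
by exists (z *+ p ^ n); [apply/IH; exists z|rewrite -mulrnA expnSr].
Qed.

Lemma ppow_onat_le (G : zmodType) p m n (x : G) : (m <= n)%N ->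
  ppow G p (onat n) x -> ppow G p (onat m) x.
Proof.
move=> mn /ppow_onatP[y ->]; apply/ppow_onatP.
by exists (y *+ p ^ (n - m)); rewrite -mulrnA -expnD subnK.
Qed.

(** Every tree denotes an ordinal, and its minimum with the finite ordinal
    [m] can be computed by recursion on the tree. The point is that the
    result does not depend on the group. *)
Lemma ppow_truncate m p a : exists k, [/\ (k <= m)%N,
  forall (G : zmodType) (x : G), ppow G p a x -> ppow G p (onat k) x &
  (k < m)%N -> forall (G : zmodType) (x : G),
     ppow G p (onat k) x -> ppow G p a x].
Proof.
elim: a => [|a [k [km ak ka]]|I F /choice[k Hk]].
- by exists 0.
- have [km'|kNm] := eqVneq k m.
    exists m; split=> [|G x /ppow_succ/ak|] //; rewrite ?ltnn// km'.
    by [].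
  have kltm : (k < m)%N by rewrite ltn_neqAle kNm.
  exists k.+1; split=> // [G x [y /ak Hy <-]|_ G x [y Hy <-]].
    by exists y.
  by exists y => //; apply: ka.
- have [[i0 _]|I0] := pselect (exists i : I, True); last first.
    (* A supremum over the empty type denotes the ordinal 0. *)
    by exists 0; split=> // _ G x _ i; case: I0; exists i.
  pose P j := `[< exists i, k i = j >].
  have exP : exists j, P j by exists (k i0); apply/asboolP; exists i0.
  have leP j : P j -> (j <= m)%N.
    by move=> /asboolP[i <-]; case: (Hk i).
  have [j /asboolP[i ij] maxj] := ex_maxnP exP leP.
  have kj i' : (k i' <= j)%N by apply: maxj; apply/asboolP; exists i'.
  exists j; split=> [|G x /= /(_ i)|jm G x Hx i' /=].
  - by rewrite -ij; case: (Hk i).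
  - by case: (Hk i) => _ + _; rewrite ij; apply.
  - case: (Hk i') => _ _; apply; first exact: leq_ltn_trans jm.
    exact: ppow_onat_le Hx.
Qed.

(** To compare heights it is enough to look at finite ordinals, provided
    that all transfinite ordinals are harmless on the side of [y]: a tree
    denotes either a finite ordinal or one that exceeds all of them. *)
Lemma ppow_le_finite (G H : zmodType) p (x : G) (y : H) :
  (forall n, ppow G p (onat n) x -> ppow H p (onat n) y) ->
  ((forall n, ppow H p (onat n) y) -> forall a, ppow H p a y) ->
  forall a, ppow G p a x -> ppow H p a y.
Proof.
move=> xy yoo a.
have [/yoo//|/existsNP[n yn]] := pselect (forall n, ppow H p (onat n) y).
have [k [kn ak ka]] := ppow_truncate n p a.
move=> /ak/xy Hy; move: kn; rewrite leq_eqVlt => /predU1P[kn|kn].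
  by case: yn; rewrite -kn.
exact: ka.
Qed.

(** * Balanced sequences and lifting of elements *)

(** One half of balancedness, seen from the epimorphism: the socles of the
    groups [p^a B] are mapped onto the socles of the groups [p^a C]. *)
Definition socle_lifting (B C : zmodType) (g : {additive B -> C}) : Prop :=
  forall p a c, prime p -> ppow C p a c -> c *+ p = 0 ->
    exists b, [/\ ppow B p a b, b *+ p = 0 & g b = c].

(** The other half of balancedness: preimages can be chosen that lose no
    height at any prime. *)
Definition height_lifting (B C : zmodType) (g : {additive B -> C}) : Prop :=
  forall c, exists b, g b = c /\
    forall p a, prime p -> ppow C p a c -> ppow B p a b.

(** The trees allowed by [x] need not form a set over which a supremum can
    be taken, but for each element [z] of [H] one tree that witnesses a
    failure is enough, and these are indexed by [H]. *)
Lemma ppow_dominating (G H : zmodType) p (x : G) : exists a, ppow G p a x /\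
  forall b, ppow G p b x -> ppow H p a `<=` ppow H p b.
Proof.
have /choice[F HF] : forall z : H, exists a, ppow G p a x /\
    (ppow H p a z -> forall b, ppow G p b x -> ppow H p b z).
  move=> z; have [Hz|/existsNP[a /not_implyP[xa za]]] :=
    pselect (forall b, ppow G p b x -> ppow H p b z).
    by exists ozero.
  by exists a.
exists (osup F); split=> [z|b xb z /(_ z) zz]; first by case: (HF z).
by have [_ /(_ zz b xb)] := HF z.
Qed.

(** Balancedness is applied to the generalized height that records at each
    prime a tree dominating the heights of [c]. *)
Lemma balanced_height_lifting (A B C : zmodType) (f : {additive A -> B})
    (g : {additive B -> C}) : balanced f g -> height_lifting g.
Proof.
move=> [_ bal] c; have /choice[h hP] := fun p => @ppow_dominating C B p c.
have [_ _ gE] := bal (fun p => Some (h p)).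
have : height_subgroup (fun p => Some (h p)) C c by move=> p _; case: (hP p).
rewrite -gE => -[b bh gb]; exists b; split=> // p a pp ca.
by have [_] := hP p; apply; [exact: ca|exact: bh].
Qed.

Definition height_at p a : generalized_height :=
  fun q => if q == p then Some a else Some ozero.

Lemma height_atE p a (G : zmodType) : prime p ->
  height_subgroup (height_at p a) G = ppow G p a.
Proof.
move=> pp; apply/seteqP; split=> [x /(_ p pp)|x Hx q _]; rewrite /height_at.
  by rewrite eqxx.
by case: eqP => [->|].
Qed.

(** A preimage [b] in [p^a B] has [p b] in the kernel and in [p^(a+1) B],
    hence in [p^(a+1) A]; subtracting an element of [p^a A] with the same
    multiple by [p] makes the order of [b] equal to [p]. *)
Lemma balanced_socle_lifting (A B C : zmodType) (f : {additive A -> B})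
    (g : {additive B -> C}) : balanced f g -> socle_lifting g.
Proof.
move=> [_ bal] p a c pp; have [_ _] := bal (height_at p a).
have [_ + _] := bal (height_at p (osucc a)).
rewrite !height_atE// => kerE imE; rewrite -{1}imE => -[b Hb <-{c}] gbp.
have : (ppow B p (osucc a) `&` [set y | g y = 0]) (b *+ p).
  by split; [exists b|rewrite /= raddfMn].
rewrite -kerE => -[_ [d Hd <-] e].
exists (b - f d); split; first by apply: ppowB => //; apply: ppow_hom.
  by rewrite mulrnBl -raddfMn e subrr.
have [_ + _] := bal (height_at p a).
rewrite !height_atE// => /seteqP[/(_ (f d)) + _].
by move=> [|_ /= gfd]; [exists d|rewrite raddfB gfd subr0].
Qed.

(** Conversely the lifting properties make the kernel isotype: if [p b] lies
    in the kernel with [b] in [p^a B], then [b] can be moved into the kernel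
    by an element of order [p] of [p^a B]. The exactness on [h(A)], [h(B)],
    [h(C)] follows prime by prime. *)
Lemma balancedP (A B C : zmodType) (f : {additive A -> B})
    (g : {additive B -> C}) :
  short_exact_on f g setT setT setT -> socle_lifting g -> height_lifting g ->
  balanced f g.
Proof.
move=> [finj fE gE] sg hg; split=> //.
have fI : injective f by move=> x y; apply: finj; rewrite inE.
have fg x : g (f x) = 0.
  have : (f @` setT) (f x) by exists x.
  by rewrite fE => -[].
have isotype p a x : prime p -> ppow B p a (f x) -> ppow A p a x.
  move=> pp; elim: a x => [|a IH|I F IH] x //=; last first.
    by move=> Hx i; apply: IH.
  move=> [b Hb e].
  have [|b' [Hb' b'p gb']] := sg p a (g b) pp (ppow_hom _ Hb).
    by rewrite -raddfMn e fg.
  have : ([set: B] `&` [set y | g y = 0]) (b - b').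
    by split=> //=; rewrite raddfB gb' subrr.
  rewrite -fE => -[d _ fd]; exists d.
    by apply: IH; rewrite fd; apply: ppowB.
  by apply: fI; rewrite raddfMn fd mulrnBl b'p subr0.
have hom_h (h : generalized_height) (X Y : zmodType) (k : {additive X -> Y}) x :
    height_subgroup h X x -> height_subgroup h Y (k x).
  move=> Hx p pp; move: (Hx p pp); case: (h p) => [a|]; first exact: ppow_hom.
  by move=> xoo a; apply: ppow_hom; apply: xoo.
move=> h; split; first by move=> x y _ _; apply: fI.
- apply/seteqP; split=> [_ [x Hx <-]|y [Hy gy]].
    by split; [apply: hom_h|apply: fg].
  have : ([set: B] `&` [set y | g y = 0]) y by [].
  rewrite -fE => -[x _ xy]; exists x => // p pp; move: (Hy p pp).
  rewrite -xy; case: (h p) => [a|]; first exact: isotype.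
  by move=> yoo a; apply: isotype.
- apply/seteqP; split=> [_ [x Hx <-]|c Hc]; first exact: hom_h.
  have [b [gb bh]] := hg c; exists b => // p pp; move: (Hc p pp).
  case: (h p) => [a|]; first exact: bh.
  by move=> coo a; apply: bh.
Qed.

(** At finite ordinals, socle lifting says that the kernel is pure, so
    elements of order dividing [p^k] lift with the same order; the order is
    reduced one factor at a time. *)
Lemma socle_lifting_order (B C : zmodType) (g : {additive B -> C}) :
  socle_lifting g -> forall p k c, prime p -> c *+ p ^ k = 0 ->
  exists b, b *+ p ^ k = 0 /\ g b = c.
Proof.
move=> sg p k c pp; elim: k c => [|k IH] c.
  by rewrite expn0 => c0; exists 0; rewrite raddf0 mul0rn.
rewrite expnSr mulrnA => ck.
have [|b [/ppow_onatP[b0 ->] b0p gb]] := sg p (onat k) (c *+ p ^ k) pp _ ck.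
  by apply/ppow_onatP; exists c.
have [|b1 [b1k gb1]] := IH (c - g b0).
  by rewrite mulrnBl -raddfMn gb subrr.
exists (b0 + b1); rewrite raddfD gb1 subrKC; split=> //.
by rewrite mulrnDl !mulrnA b0p add0r b1k mul0rn.
Qed.

(** * Extension of partial homomorphisms *)

Section PartialHom.
Variables (G B : zmodType).
Implicit Types (Gam : set (G * B)).

(** Graphs of homomorphisms defined on subgroups. Graphs are convenient for
    Zorn's lemma, as the union of a chain is again a graph. *)
Definition partial_hom Gam : Prop := [/\ Gam (0, 0),
  forall x a y b, Gam (x, a) -> Gam (y, b) -> Gam (x - y, a - b) &
  forall b, Gam (0, b) -> b = 0].

Definition domain Gam : set G := [set x | exists b, Gam (x, b)].

Definition adjoin Gam (x : G) (y : B) : set (G * B) :=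
  [set u | exists s b k, Gam (s, b) /\ u = (s + x *~ k, b + y *~ k)].

Section Theory.
Variable Gam : set (G * B).
Hypothesis hGam : partial_hom Gam.

Lemma partial_homB x a y b : Gam (x, a) -> Gam (y, b) -> Gam (x - y, a - b).
Proof. by case: hGam => _ + _; apply. Qed.

Lemma partial_homN x a : Gam (x, a) -> Gam (- x, - a).
Proof.
by move=> xa; rewrite -sub0r -[- a]sub0r; apply: partial_homB => //; case: hGam.
Qed.

Lemma partial_homD x a y b : Gam (x, a) -> Gam (y, b) -> Gam (x + y, a + b).
Proof.
by move=> xa /partial_homN yb; rewrite -[y]opprK -[b]opprK; apply: partial_homB.
Qed.

Lemma partial_homMn x a n : Gam (x, a) -> Gam (x *+ n, a *+ n).
Proof.
move=> xa; elim: n => [|n IH]; first by rewrite !mulr0n; case: hGam.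
by rewrite !mulrS; apply: partial_homD.
Qed.

Lemma partial_homMz x a (k : int) : Gam (x, a) -> Gam (x *~ k, a *~ k).
Proof.
by case: k => n xa; [|apply: partial_homN]; apply: partial_homMn.
Qed.

Lemma partial_hom_inj x a b : Gam (x, a) -> Gam (x, b) -> a = b.
Proof.
move=> xa xb; apply/subr0_eq; case: hGam => _ _; apply.
by rewrite -(subrr x); apply: partial_homB.
Qed.

Lemma domainB x y : domain Gam x -> domain Gam y -> domain Gam (x - y).
Proof. by move=> [a xa] [b yb]; exists (a - b); apply: partial_homB. Qed.

Lemma domain0 : domain Gam 0. Proof. by exists 0; case: hGam. Qed.

Lemma domainD x y : domain Gam x -> domain Gam y -> domain Gam (x + y).
Proof. by move=> [a xa] [b yb]; exists (a + b); apply: partial_homD. Qed.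

Lemma domainMz x (k : int) : domain Gam x -> domain Gam (x *~ k).
Proof. by move=> [a xa]; exists (a *~ k); apply: partial_homMz. Qed.

Lemma domainMn x n : domain Gam x -> domain Gam (x *+ n).
Proof. by rewrite pmulrn; apply: domainMz. Qed.

Lemma partial_hom_total : (forall x, domain Gam x) ->
  exists psi : {additive G -> B}, forall x, Gam (x, psi x).
Proof.
move=> /choice[f fG].
have fB : zmod_morphism f.
  by move=> x y; apply: (partial_hom_inj (fG _)); apply: partial_homB.
by have [psi psiE] := ex_additive fB; exists psi => x; rewrite psiE.
Qed.

Lemma sub_adjoin x y : Gam `<=` adjoin Gam x y.
Proof.
by move=> [s b] sb; exists s, b, 0; rewrite !mulr0z !addr0.
Qed.

Lemma adjoin_mem x y : adjoin Gam x y (x, y).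
Proof. by exists 0, 0, 1; rewrite !add0r; case: hGam. Qed.

(** If [N] is the exact order of [x] modulo the domain, then the value at
    [x] is only constrained on [N x]. *)
Lemma adjoin_partial_hom x y (N : nat) : Gam (x *+ N, y *+ N) ->
  (forall k, domain Gam (x *~ k) -> (N %| k)%Z) -> partial_hom (adjoin Gam x y).
Proof.
move=> xyN orderN; split; first by apply: sub_adjoin; case: hGam.
  move=> _ _ _ _ [s [b [k [sb [-> ->]]]]] [s' [b' [k' [sb' [-> ->]]]]].
  exists (s - s'), (b - b'), (k - k'); split; first exact: partial_homB.
  by rewrite !mulrzBr; congr (_, _); rewrite opprD addrACA.
move=> _ [s [b [k [sb [e ->]]]]].
have xk : Gam (x *~ k, - b).
  have -> : x *~ k = - s by apply/esym/eqP; rewrite eqr_oppLR -addr_eq0 e.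
  exact: partial_homN.
have /dvdzP[l kE] := orderN k (ex_intro _ _ xk).
have : Gam (x *~ k, y *~ k).
  rewrite kE mulrC !mulrzA -!pmulrn; exact: partial_homMz.
by move=> /(partial_hom_inj xk) <-; rewrite subrr.
Qed.

End Theory.

Lemma partial_hom_bigcup (F : set (set (G * B))) : F !=set0 ->
  (forall Gam, F Gam -> partial_hom Gam) -> total_on F subset ->
  partial_hom (\bigcup_(Gam in F) Gam).
Proof.
move=> [Gam0 FG0] hF Ftot; split.
- by exists Gam0 => //; case: (hF _ FG0).
- move=> x a y b [Gam FG xa] [Gam' FG' yb].
  have [sub|sub] := Ftot _ _ FG FG'.
    by exists Gam' => //; apply: (partial_homB (hF _ FG')) => //; apply: sub.
  by exists Gam => //; apply: (partial_homB (hF _ FG)) => //; apply: sub.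
- by move=> b [Gam FG]; case: (hF _ FG) => _ _; apply.
Qed.

(** Zorn's lemma for partial homomorphisms that satisfy a condition [P]: it
    is enough to enlarge the domain by one element at a time. *)
Lemma partial_hom_extend (P : set (set (G * B))) (Gam0 : set (G * B)) :
  P Gam0 -> P `<=` partial_hom ->
  (forall F : set (set (G * B)), F !=set0 -> F `<=` P -> total_on F subset ->
    P (\bigcup_(X in F) X)) ->
  (forall Gam x, P Gam -> Gam0 `<=` Gam -> ~ domain Gam x -> exists x' y',
     ~ domain Gam x' /\ P (adjoin Gam x' y')) ->
  exists (Gam : set (G * B)) (psi : {additive G -> B}),
    [/\ P Gam, Gam0 `<=` Gam & forall x, Gam (x, psi x)].
Proof.
move=> PG0 Phom Pcup Pstep.
have [Gam [G0 PG maxG]] := Zorn_above PG0 Pcup.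
have hG := Phom _ PG.
have [|psi psiG] := partial_hom_total hG; last by exists Gam, psi.
move=> x; apply: contrapT => xG; have [x' [y' [x'G PG']]] := Pstep _ _ PG G0 xG.
case: x'G; exists y'; apply: (maxG _ _ PG'); last exact: adjoin_mem.
exact: sub_adjoin.
Qed.

End PartialHom.

(** An element of finite order modulo [S] has a multiple whose order modulo
    [S] is a prime, so only prime steps are needed to extend homomorphisms. *)
Lemma prime_multiple (G : zmodType) (S : set G) (x : G) n : (0 < n)%N ->
  S (x *+ n) -> ~ S x ->
  exists m p, [/\ prime p, S (x *+ m *+ p) & ~ S (x *+ m)].
Proof.
move=> n0 Sxn Sx; pose P j := (0 < j)%N && `[< S (x *+ j) >].
have exP : exists j, P j by exists n; rewrite /P n0; apply/asboolP.
have [j /andP[j0 /asboolP Sj] minj] := ex_minnP exP.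
have j1 : (1 < j)%N.
  rewrite ltn_neqAle j0 andbT; apply/eqP => j1; case: Sx.
  by rewrite -[x]mulr1n j1.
exists (j %/ pdiv j)%N, (pdiv j); split; first exact: pdiv_prime.
  by rewrite -mulrnA divnK ?pdiv_dvd.
move=> Sd; have := minj (j %/ pdiv j)%N; rewrite /P asboolT// andbT.
rewrite divn_gt0 ?pdiv_gt0// pdiv_leq// => /(_ isT).
by rewrite leqNgt ltn_Pdiv// prime_gt1// pdiv_prime.
Qed.

(** * Lifting homomorphisms from torsion groups *)

Section TorsionLifting.
Variables (T B C : zmodType) (g : {additive B -> C}) (phi : {additive T -> C}).
Hypothesis sg : socle_lifting g.
Hypothesis torT : forall x : T, exists2 n, (0 < n)%N & x *+ n = 0.
Hypothesis bT : bounded_p_torsion T.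

Let pure (S : set T) := forall p j t, prime p -> S (t *+ p ^ j) ->
  exists s, S s /\ t *+ p ^ j = s *+ p ^ j.

Let P (Gam : set (T * B)) := [/\ partial_hom Gam,
  (forall x b, Gam (x, b) -> g b = phi x) & pure (domain Gam)].

Lemma dvd_order (Gam : set (T * B)) p k x (a : int) : partial_hom Gam ->
  prime p -> domain Gam (x *+ p ^ k.+1) -> ~ domain Gam (x *+ p ^ k) ->
  domain Gam (x *~ a) -> ((p ^ k.+1)%N %| a)%Z.
Proof.
move=> hG pp xk1 xk xa.
have [j jk jE] : exists2 j, (j <= k.+1)%N & gcdn (p ^ k.+1) `|a| = (p ^ j)%N.
  by apply/(dvdn_pfactor _ _ pp); apply: dvdn_gcdl.
rewrite dvdzE /=; move: jk; rewrite leq_eqVlt => /predU1P[jk|jk].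
  by apply/gcdn_idPl; rewrite jE jk.
case: xk; suff : domain Gam (x *+ p ^ j).
  by rewrite ltnS in jk; rewrite -(subnKC jk) expnD mulrnA; apply: domainMn.
have [u [v uv]] := Bezoutz (p ^ k.+1)%N a.
rewrite pmulrn -jE -[X in _ *~ X]/(gcdz (p ^ k.+1)%N a) -uv mulrzDr.
rewrite [u * _]mulrC [v * _]mulrC !mulrzA -pmulrn.
by apply: domainD => //; apply: domainMz.
Qed.

(** A maximal lift among those that are defined on pure subgroups is total.
    Modulo a pure subgroup [S], the [p]-component is bounded again, so it
    has an element of maximal order, and purity provides a representative
    [x] of the same order. Its image in [C] lifts to an element of [B] of
    the same order, and [S] together with [x] generates a pure subgroup
    because [x] has maximal order modulo [S]. *)
Lemma torsion_lift : exists psi : {additive T -> B}, forall x, g (psi x) = phi x.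
Proof.
have [||F F0 FP Ftot|Gam x0 [hG liftG pureG] _ x0G|Gam [psi [[_ liftG _] _ psiG]]] :=
  @partial_hom_extend T B P [set (0, 0)].
- split.
  + split=> // [_ _ _ _ [-> ->] [-> ->]|b [//]].
    by rewrite !subr0.
  + by move=> _ _ [-> ->]; rewrite !raddf0.
  + move=> p j t _ [_ [tj _]]; exists 0; rewrite tj mul0rn; split=> //.
    by exists 0.
- by move=> Gam [].
- split.
  + by apply: partial_hom_bigcup => // Gam /FP[].
  + by move=> x b [Gam /FP[_ + _] xb]; apply.
  + move=> p j t pp [b [Gam FG tb]]; have [_ _ pureG] := FP _ FG.
    have [|s [[b' sb'] ->]] := pureG p j t pp; first by exists b.
    by exists s; split=> //; exists b', Gam.
- have [n n0 x0n] := torT x0.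
  have [|m [p [pp x1p x1]]] := prime_multiple (S := domain Gam) n0 _ x0G.
    by rewrite x0n; apply: domain0.
  have [e eP] := bT pp.
  pose bnd k := `[< forall t, (exists i, domain Gam (t *+ p ^ i)) ->
    domain Gam (t *+ p ^ k) >].
  have exb : exists k, bnd k.
    (* Purity carries the bound for the p-torsion of T over to T modulo the
       domain. *)
    exists e; apply/asboolP => t [i ti].
    have [s [sG tsi]] := pureG p i t pp ti.
    have tse : t *+ p ^ e = s *+ p ^ e.
      apply/subr0_eq; rewrite -mulrnBl; apply: eP; exists i.
      by rewrite mulrnBl tsi subrr.
    by rewrite tse; apply: domainMn.
  have [[|k] /asboolP bk mink] := ex_minnP exb.
    by case: x1; rewrite -[_ *+ m]mulr1n; apply: bk; exists 1%N.
  have /asboolPn/existsNP[t /not_implyP[ti tk]] : ~~ bnd k.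
    by apply/negP => /mink; rewrite ltnn.
  have [s [sG tsk]] := pureG p k.+1 t pp (bk t ti).
  pose x := t - s.
  have xk1 : x *+ p ^ k.+1 = 0 by rewrite mulrnBl tsk subrr.
  have xk : ~ domain Gam (x *+ p ^ k).
    move=> xk; apply: tk; rewrite -[t](subrK s) mulrnDl.
    by apply: domainD => //; apply: domainMn.
  have [|y [yk gy]] := socle_lifting_order sg (c := phi x) pp (k := k.+1).
    by rewrite -raddfMn xk1 raddf0.
  exists x, y; split.
    by move=> xG; apply: xk; apply: domainMn.
  have G00 : Gam (0, 0) by case: hG.
  have xk1G : domain Gam (x *+ p ^ k.+1) by rewrite xk1; apply: domain0.
  split.
  + apply: (@adjoin_partial_hom _ _ _ _ _ _ (p ^ k.+1)) => //.
      by rewrite xk1 yk.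
    by move=> a; apply: dvd_order.
  + move=> _ _ [s' [b [a [sb [-> ->]]]]].
    by rewrite !raddfD (liftG _ _ sb) !raddfMz gy.
  + move=> q j t' pq [_ [s' [b [a [sb [t'E _]]]]]].
    (* By purity of the old domain it is enough to divide modulo that
       domain. *)
    suff [x' [x'G x's]] : exists x', domain (adjoin Gam x y) x' /\
        domain Gam ((t' - x') *+ q ^ j).
      have [z [[c zc] zE]] := pureG q j _ pq x's.
      exists (z + x'); split; last by rewrite mulrnDl -zE mulrnBl subrK.
      case: x'G => d [u [v [l [uv [-> _]]]]].
      exists (c + v + y *~ l), (z + u), (c + v), l.
      by split; [apply: partial_homD|rewrite addrA].
    have s'G : domain Gam s' by exists b.
    have memx l : domain (adjoin Gam x y) (x *~ l).
      by exists (y *~ l), 0, 0, l; rewrite !add0r.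
    have [pq_eq|pNq] := eqVneq q p; last first.
      have /(bezout_split T)[u [v uv]] : coprime (q ^ j) (p ^ k.+1).
        by rewrite coprimeXl// coprimeXr// prime_coprime// dvdn_prime2.
      exists (x *~ (u * a)); split=> //.
      have xu : x = x *~ u *+ q ^ j.
        by rewrite {1}(uv x) [x *~ v *+ _]pmulrn mulrzAC -pmulrn xk1 mul0rz addr0.
      have -> : (t' - x *~ (u * a)) *+ q ^ j = s' => //.
      rewrite mulrnBl t'E mulrzA [_ *~ a *+ _]pmulrn mulrzAC -pmulrn -xu.
      by rewrite addrK.
    rewrite {}pq_eq in t'E *.
    have t'k : domain Gam (t' *+ p ^ k.+1).
      apply: bk; exists (j + k.+1)%N; rewrite expnD mulrnA t'E mulrnDl.
      rewrite [_ *~ a *+ _]pmulrn mulrzAC -pmulrn xk1 mul0rz addr0.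
      exact: domainMn.
    have [kj|jk] := leqP k.+1 j.
      exists 0; rewrite subr0 -(subnKC kj) expnD mulrnA; split.
        by have := memx 0; rewrite mulr0z.
      exact: domainMn.
    have /dvdzP[a' aE] : ((p ^ j)%N %| a)%Z.
      have := dvd_order (a := a * (p ^ (k.+1 - j))%N) hG pp xk1G xk.
      rewrite -{3}(subnKC (ltnW jk)) expnD PoszM dvdz_mul2r.
        apply; rewrite mulrzA -pmulrn.
        have -> : x *~ a = t' *+ p ^ j - s' by rewrite t'E addrC addKr.
        rewrite mulrnBl -mulrnA -expnD subnKC ?(ltnW jk)//.
        by apply: domainB => //; apply: domainMn.
      by rewrite -lt0n expn_gt0 prime_gt0.
    exists (x *~ a'); split=> //.
    have -> : (t' - x *~ a') *+ p ^ j = s' => //.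
    by rewrite mulrnBl t'E aE mulrzA -pmulrn addrK.
- by exists psi => x; apply: liftG.
Qed.

End TorsionLifting.

(** * Lifting homomorphisms from torsion-free groups of rank one *)

Lemma ppow_coprimez (G : zmodType) (p : nat) a (x : G) (m : int) : coprimez m p ->
  ppow G p a (x *~ m) -> ppow G p a x.
Proof.
case: m => n; rewrite /coprimez /gcdz /= ?NegzE ?absz_nat ?abszN => cmp.
  exact: ppow_coprime.
by rewrite mulrNz => /ppowN; rewrite opprK; apply: ppow_coprime.
Qed.

Lemma prime_coprimez (p : nat) (m : int) : prime p ->
  coprimez m p = ~~ (p%:Z %| m)%Z.
Proof.
move=> pp; rewrite /coprimez /gcdz absz_nat gcdnC.
by rewrite -[_ == _]/(coprime p `|m|) prime_coprime// dvdzE.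
Qed.

Lemma coprimez_dvdC (p : nat) (m : int) : prime p ->
  ~ (p%:Z %| m)%Z -> coprimez m p.
Proof. by move=> pp /negP; rewrite prime_coprimez. Qed.

Section HeightExtension.
Variables (R B C : zmodType) (g : {additive B -> C}) (phi : {additive R -> C}).
Hypothesis sg : socle_lifting g.
Hypothesis tfR : torsion_free R.
Variable r : R.
Hypothesis r0 : r != 0.
Hypothesis rank1 : forall x, exists (m k : int), m != 0 /\ x *~ m = r *~ k.

Let dominates p (x : R) (b : B) := forall a, ppow R p a x -> ppow B p a b.

(** In a torsion-free group division by [p] is unique, so it lowers the
    height at [p] by one; a tree for the lowered ordinal is found by
    recursion. *)
Lemma ppow_torsion_free_divide p a (z : R) : prime p -> ppow R p a (z *+ p) ->
  exists a', ppow R p a' z /\ forall w : B, ppow B p a' w -> ppow B p a (w *+ p).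
Proof.
move=> pp; elim: a z => [|a IH|I F IH] z /=.
- by exists ozero.
- move=> [w Hw wz]; exists a; split; last by move=> v Hv; exists v.
  have -> // : z = w.
  apply/subr0_eq/(tfR (prime_gt0 pp)).
  by rewrite mulrnBl wz subrr.
- move=> Hz; have /choice[F' F'P] := fun i => IH i z (Hz i).
  exists (osup F'); split=> [i|w Hw i] /=; first by case: (F'P i).
  by case: (F'P i) => _; apply; apply: Hw.
Qed.

Lemma dominatesMz p x b (k : int) : prime p ->
  dominates p x b -> dominates p (x *~ k) (b *~ k).
Proof.
move=> pp xb.
have nat_case n : dominates p (x *+ n) (b *+ n).
  elim/ltn_ind: n => n IH a.
  have [->|n0] := posnP n; first by rewrite mulr0n; move=> _; apply: ppow0.
  have [/dvdnP[m nE]|pn] := boolP (p %| n)%N.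
    rewrite nE !mulrnA => /(ppow_torsion_free_divide pp)[a' [Hx]]; apply.
    apply: IH => //; rewrite nE in n0 *.
    by rewrite ltn_Pmulr ?prime_gt1//; lia.
  move=> /ppow_coprime Hx; apply/ppowMn/xb/Hx.
  by rewrite coprime_sym prime_coprime.
case: k => n a; first exact: nat_case.
by move=> /ppowN; rewrite opprK => Hx; apply/ppowN/nat_case.
Qed.

Let P (Gam : set (R * B)) := [/\ partial_hom Gam,
  (forall x b, Gam (x, b) -> g b = phi x) &
  (forall x b p, Gam (x, b) -> prime p -> dominates p x b)].

(** One step of the extension: [y] is first chosen in [p^a B] as a quotient
    of the old value, where [a] dominates the heights of [x]; its image then
    differs from [phi x] by an element of order [p] of [p^a C], which lifts
    to a correction of order [p] in [p^a B]. *)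
Lemma divide_lift p (x : R) (b : B) : prime p -> g b = phi (x *+ p) ->
  dominates p (x *+ p) b ->
  exists y, [/\ y *+ p = b, g y = phi x & dominates p x y].
Proof.
move=> pp gb xb; have [a [xa adom]] := ppow_dominating B p x.
have [y Hy yb] : ppow B p (osucc a) b by apply: xb; exists x.
have [|||e [He ep ge]] := sg (p := p) (a := a) (c := g y - phi x).
- exact: pp.
- by apply: ppowB; [apply: ppow_hom|apply: ppow_hom].
- by rewrite mulrnBl -!raddfMn yb gb subrr.
exists (y - e); split.
- by rewrite mulrnBl yb ep subr0.
- by rewrite raddfB ge opprB addrC subrK.
- by move=> a' xa'; apply: (adom a' xa'); apply: ppowB.
Qed.

(** A relation between [s] and [x] in a torsion-free group can be divided by
    the greatest common divisor of its coefficients. *)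
Lemma divide_common (p : nat) (s x : R) (m l : int) : prime p -> m != 0 ->
  s *~ m = x *~ l ->
  exists m' l', s *~ m' = x *~ l' /\ ~ ((p%:Z %| m')%Z /\ (p%:Z %| l')%Z).
Proof.
move=> pp m0 sx; pose d := gcdz m l.
have d0 : d != 0 by rewrite gcdz_eq0 (negPf m0).
have [m' mE] := dvdzP (dvdz_gcdl m l); have [l' lE] := dvdzP (dvdz_gcdr m l).
exists m', l'; split.
  apply: (torsion_free_mulzI tfR d0); rewrite /= -!mulrzA.
  by rewrite -mE -lE.
move=> [pm pl].
have : (p%:Z * d %| 1 * d)%Z.
  rewrite mul1r dvdz_gcd; apply/andP; split.
    by rewrite [X in (_ %| X)%Z]mE dvdz_mul2r.
  by rewrite [X in (_ %| X)%Z]lE dvdz_mul2r.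
rewrite dvdz_mul2r// dvdzE /= dvdn1 => /eqP p1.
by rewrite p1 in pp.
Qed.

(** Partial lifts that do not lower heights are extended by Zorn's lemma,
    starting from the multiples of [r]. When [x] is adjoined with [p x] in
    the domain, heights at primes other than [p] can be tested after
    multiplication by [p], which leads back to the old domain. For the
    height at [p] the rank one matters: an element outside the domain is, up
    to a factor prime to [p], a multiple of [x] by an integer prime to [p]. *)
Lemma height_extension (b0 : B) : g b0 = phi r ->
  (forall p, prime p -> dominates p r b0) ->
  exists psi : {additive R -> B}, (forall x, g (psi x) = phi x) /\ psi r = b0.
Proof.
move=> gb0 rb0.
pose Gam0 : set (R * B) := [set u | exists k : int, u = (r *~ k, b0 *~ k)].
have [||F F0 FP Ftot|Gam x0 [hG liftG domG] G0 x0G|Gam [psi [[hG liftG _] G0 psiG]]] :=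
  @partial_hom_extend R B P Gam0.
- split; last by move=> _ _ p [k [-> ->]] pp; apply: dominatesMz => //; apply: rb0.
    split; first by exists 0; rewrite !mulr0z.
      by move=> _ _ _ _ [k [-> ->]] [l [-> ->]]; exists (k - l); rewrite !mulrzBr.
    move=> _ [k [rk ->]]; have [->|k0] := eqVneq k 0; first by rewrite mulr0z.
    by move: r0; rewrite (torsion_free_mulz tfR k0 (esym rk)) eqxx.
  by move=> _ _ [k [-> ->]]; rewrite !raddfMz gb0.
- by move=> Gam [].
- split.
  + by apply: partial_hom_bigcup => // Gam /FP[].
  + by move=> x b [Gam /FP[_ + _] xb]; apply.
  + by move=> x b p [Gam /FP[_ _ +] xb]; apply.
- have rG : domain Gam r by exists b0; apply: G0; exists 1.
  have [n n0 x0n] : exists2 n, (0 < n)%N & domain Gam (x0 *+ n).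
    have [m [k [m0 x0m]]] := rank1 x0; exists `|m|%N; first by rewrite absz_gt0.
    have x0m' : domain Gam (x0 *~ m) by rewrite x0m; apply: domainMz.
    case: m {m0 x0m} x0m' => j //= x0j.
    by rewrite -[x0 *+ _]opprK -sub0r; apply: domainB => //; apply: domain0.
  have [m [p [pp [b xb] xG]]] := prime_multiple n0 x0n x0G.
  move: (x0 *+ m) xb xG => {x0 x0G n n0 x0n m} x xb xG.
  have [y [yb gy xy]] := divide_lift pp (liftG _ _ xb) (domG _ _ _ xb pp).
  exists x, y; split=> //.
  have xpG : domain Gam (x *+ p) by exists b.
  have pdvd k : domain Gam (x *~ k) -> (p%:Z %| k)%Z.
    move=> xkG; apply: contrapT => /(coprimez_dvdC pp) kp; apply: xG.
    have [[u v] /= uv] := coprimezP _ _ kp.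
    rewrite -[x]mulr1z -uv mulrzDr [u * _]mulrC [v * _]mulrC !mulrzA -pmulrn.
    by apply: domainD => //; apply: domainMz.
  split.
  + by apply: (adjoin_partial_hom hG) pdvd; rewrite yb.
  + move=> _ _ [s [c [k [sc [-> ->]]]]].
    by rewrite !raddfD (liftG _ _ sc) !raddfMz gy.
  + move=> _ _ q [s [c [k [sc [-> ->]]]]] pq.
    have [qp|qNp] := eqVneq q p; last first.
      have cpq : coprime p q by rewrite prime_coprime// dvdn_prime2// eq_sym.
      move=> a Ha; apply: (ppow_coprime cpq).
      apply: (domG ((s + x *~ k) *+ p)) => //; last exact: ppowMn.
      rewrite !mulrnDl; apply: partial_homD => //; first exact: partial_homMn.
      rewrite [x *~ k *+ p]pmulrn [y *~ k *+ p]pmulrn [x *~ k *~ p]mulrzAC.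
      rewrite [y *~ k *~ p]mulrzAC -!pmulrn yb.
      exact: partial_homMz.
    rewrite {q pq}qp.
    have [/dvdzP[k' kE]|pk] := boolP (p%:Z %| k)%Z.
      apply: domG => //; apply: partial_homD => //.
      rewrite kE mulrC !mulrzA -!pmulrn yb; exact: partial_homMz.
    have [m [l [m0 sm]]] : exists m l : int, m != 0 /\ s *~ m = x *~ l.
      have [m1 [k1 [m10 xm]]] := rank1 x; have [m2 [k2 [m20 sm]]] := rank1 s.
      have k10 : k1 != 0.
        apply/eqP => k10; apply: xG; move: xm; rewrite k10 mulr0z.
        by move=> /(torsion_free_mulz tfR m10) ->; apply: domain0.
      exists (m2 * k1), (m1 * k2); split; first by rewrite mulf_neq0.
      by rewrite !mulrzA sm mulrzAC -xm.
    have [m' [l' [sm' npml]]] := divide_common pp m0 sm.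
    have sG : domain Gam s by exists c.
    have pl' : (p%:Z %| l')%Z by apply: pdvd; rewrite -sm'; apply: domainMz.
    have pm' : coprimez m' p.
      by apply: coprimez_dvdC => // pm'; apply: npml.
    have [l'' lE] := dvdzP pl'.
    have cm' : c *~ m' = y *~ l'.
      apply: (partial_hom_inj hG (partial_homMz hG m' sc)); rewrite sm' lE.
      by rewrite mulrC !mulrzA -!pmulrn yb; apply: partial_homMz.
    move=> a Ha; apply: (ppow_coprimez pm').
    rewrite mulrzDl cm' -mulrzA -mulrzDr; apply: ppowMz; apply: xy.
    apply: (@ppow_coprimez _ _ _ _ (l' + k * m')).
      rewrite prime_coprimez// rpredDl//.
      rewrite -prime_coprimez// coprimezMl pm' andbT prime_coprimez//.
    rewrite mulrzDr mulrzA -sm' -mulrzDl; exact: ppowMz.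
- exists psi; split=> [x|]; first exact: liftG.
  by apply: (partial_hom_inj hG (psiG r)); apply: G0; exists 1.
Qed.

End HeightExtension.

(** * Pure subgroups of rank one *)

Section RankOne.
Variable A : zmodType.
Hypothesis tfA : torsion_free A.

(** In a torsion-free group the elements [w] with [dep b w] form the pure
    subgroup generated by [b], which has rank one unless [b] is zero. *)
Definition dep (b w : A) : Prop := exists m k : int, m != 0 /\ w *~ m = b *~ k.

Lemma dep0r b : dep b 0. Proof. by exists 1, 0; rewrite mul0rz mulr0z. Qed.

Lemma dep_refl b : dep b b. Proof. by exists 1, 1. Qed.

Lemma depB b w w' : dep b w -> dep b w' -> dep b (w - w').
Proof.
move=> [m [k [m0 wm]]] [m' [k' [m'0 wm']]].
exists (m * m'), (k * m' - k' * m); split; first by rewrite mulf_neq0.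
by rewrite mulrzBl !mulrzBr !mulrzA wm [w' *~ m *~ m']mulrzAC wm'.
Qed.

Lemma depN b w : dep b w -> dep b (- w).
Proof. by move=> ?; rewrite -sub0r; apply/depB => //; apply: dep0r. Qed.

Lemma depD b w w' : dep b w -> dep b w' -> dep b (w + w').
Proof. by move=> bw /depN bw'; rewrite -[w']opprK; apply: depB. Qed.

Lemma dep_trans b c w : dep b c -> dep c w -> dep b w.
Proof.
move=> [m [k [m0 cm]]] [m' [k' [m'0 wm']]].
exists (m' * m), (k * k'); split; first by rewrite mulf_neq0.
by rewrite !mulrzA wm' mulrzAC cm.
Qed.

Lemma dep_sym b w : dep b w -> w != 0 -> dep w b.
Proof.
move=> [m [k [m0 wm]]] w0; exists k, m; split; last by [].
apply: contraNneq w0 => k0; move: wm; rewrite k0 mulr0z.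
by move/(torsion_free_mulz tfA m0) => ->.
Qed.

Lemma dep_hom (f : {additive A -> A}) b w : dep b w -> dep (f b) (f w).
Proof. by move=> [m [k [m0 wm]]]; exists m, k; rewrite -!raddfMz wm. Qed.

Lemma dep_hom_eq (f g : {additive A -> A}) b w : dep b w -> f b = g b -> f w = g w.
Proof.
move=> [m [k [m0 wm]]] fgb; apply: (torsion_free_mulzI tfA m0).
by rewrite -!raddfMz wm !raddfMz fgb.
Qed.

Lemma dep_hom_id (f : {additive A -> A}) b w : dep b w -> f b = b -> f w = w.
Proof. by move=> bw fb; apply: (dep_hom_eq (g := idfun) bw). Qed.

Lemma dep_hom0 (f : {additive A -> A}) b w : dep b w -> f b = 0 -> f w = 0.
Proof. by move=> bw fb; apply: (dep_hom_eq (g := \0) bw). Qed.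

Lemma ex_zscale (k : int) : exists h : {additive A -> A}, forall x, h x = x *~ k.
Proof.
have hB : zmod_morphism (fun x : A => x *~ k) by move=> x y; rewrite mulrzBl.
by have [h hE] := ex_additive hB; exists h.
Qed.

(** * Baer's lemma on two summands of the same type *)

(** The values at [p] of two integers are comparable, so one of [K] and [L]
    divides the other up to a denominator prime to [p]. *)
Lemma cross_divide (K L : int) p : prime p -> K != 0 ->
  exists c d : int, ~ (p%:Z %| d)%Z /\ (d * L = c * K \/ d * K = c * L).
Proof.
move=> pp K0; pose e := gcdz K L.
have e0 : e != 0 by rewrite gcdz_eq0 (negPf K0).
have [K' KE] := dvdzP (dvdz_gcdl K L); have [L' LE] := dvdzP (dvdz_gcdr K L).
have [pK|pK] := pselect (p%:Z %| K')%Z; last first.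
  exists L', K'; split=> //; left; rewrite {1}LE [in RHS]KE; ring.
exists K', L'; split; last by right; rewrite {1}KE [in RHS]LE; ring.
move=> pL; have : (p%:Z * e %| 1 * e)%Z.
  rewrite mul1r dvdz_gcd; apply/andP; split.
    by rewrite [X in (_ %| X)%Z]KE dvdz_mul2r.
  by rewrite [X in (_ %| X)%Z]LE dvdz_mul2r.
rewrite dvdz_mul2r// dvdzE /= dvdn1 => /eqP p1.
by rewrite p1 in pp.
Qed.

(** Think of [w] and [w'] as rational multiples of [a] and [b]. If [f'] maps
    [b] to [m' p a], then the hypothesis on [d] and [c] says that, at the
    prime [p], the value of [f'] at [w'] is a multiple of [p w]. *)
Lemma divisible_value (p : nat) (a b w w' : A) (f' : {additive A -> A})
    (n k n' k' m m' c d : int) : prime p -> n != 0 -> n' != 0 ->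
  w *~ n = a *~ k -> w' *~ n' = b *~ k' -> f' b = a *~ (m' * p) ->
  ~ (p%:Z %| d)%Z -> d * (m' * k' * n) = c * (m * k * n') ->
  exists y, f' w' = y *+ p.
Proof.
move=> pp n0 n'0 wn w'n' f'b pd e.
have f'w' : f' w' *~ d = w *~ (m * c) *+ p.
  have nn'0 : n * n' != 0 by rewrite mulf_neq0.
  apply: (torsion_free_mulzI tfA nn'0) => /=.
  have -> : f' w' *~ d *~ (n * n') = f' (w' *~ n') *~ (d * n).
    by rewrite raddfMz -!mulrzA; congr (_ *~ _); ring.
  have -> : w *~ (m * c) *+ p *~ (n * n') = w *~ n *~ (m * c * p * n').
    by rewrite pmulrn -!mulrzA; congr (_ *~ _); ring.
  rewrite w'n' wn raddfMz f'b -!mulrzA; congr (_ *~ _).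
  transitivity (p%:Z * (d * (m' * k' * n))); first by ring.
  by rewrite e; ring.
have /coprimezP[[u v] /= uv] : coprimez d p.
  rewrite /coprimez /gcdz absz_nat gcdnC -[_ == _]/(coprime p `|d|).
  by rewrite prime_coprime//; apply/negP => pd'; apply: pd; rewrite dvdzE.
exists (w *~ (m * c) *~ u + f' w' *~ v).
rewrite mulrnDl -[LHS]mulr1z -uv mulrzDr [u * d]mulrC !mulrzA f'w'.
by rewrite !pmulrn !mulrzA [_ *~ u *~ p]mulrzAC.
Qed.

(** The pure subgroup generated by [a + b] is a direct summand if nonzero
    homomorphisms exist in both directions between the pure subgroups
    generated by [a] and by [b]. The integers [m] for which [a] can be
    mapped to [m b] form an ideal, and so do the integers for [b] and [a].
    If [m] and [m'] in the two ideals have sum 1, then the sum of the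
    homomorphisms that take [a] to [m (a + b)] and [b] to [m' (a + b)] is a
    retraction. Otherwise both ideals lie in some [p Z], so the
    homomorphisms belonging to their generators are not divisible by [p];
    but at [p] one of the two groups is at least as divisible as the other
    one, which makes one of the homomorphisms divisible by [p]. *)
Lemma diagonal_retract (a b : A) (al be f0 f0' : {additive A -> A}) :
  al a = a -> al b = 0 -> (forall x, dep a (al x)) ->
  be b = b -> be a = 0 -> (forall x, dep b (be x)) ->
  f0 a != 0 -> dep b (f0 a) -> f0' b != 0 -> dep a (f0' b) ->
  exists lam : {additive A -> A}, lam (a + b) = a + b /\
    forall x, dep (a + b) (lam x).
Proof.
move=> ala alb dal beb bea dbe f0a df0 f0b df0'.
(* Positive elements of the ideals; the least one generates. *)
pose Q (a b : A) m := (0 < m)%N && `[< exists f : {additive A -> A}, f a = b *+ m >].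
have exQ (c c' : A) (f : {additive A -> A}) : f c != 0 -> dep c' (f c) ->
    exists m, Q c c' m.
  move=> fc [m [k [m0 fm]]]; exists `|k|%N; rewrite /Q absz_gt0.
  have -> /= : k != 0.
    apply: contraNneq fc => k0; move: fm; rewrite k0 mulr0z.
    by move/(torsion_free_mulz tfA m0) => ->.
  apply/asboolP; have [h hE] := ex_zscale (m * sgz k).
  exists (h \o f); rewrite /= hE mulrzA fm -mulrzA pmulrn.
  by rewrite abszEsg mulrC.
have [m0 /andP[m00 /asboolP[f fa]] minm] := ex_minnP (exQ _ _ _ f0a df0).
have [m0' /andP[m00' /asboolP[f' f'b]] minm'] := ex_minnP (exQ _ _ _ f0b df0').
have cop : coprime m0 m0'.
  apply: contraT => ncop.
  have g1 : (1 < gcdn m0 m0')%N.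
    by rewrite ltn_neqAle gcdn_gt0 m00 andbT eq_sym.
  set p := pdiv (gcdn m0 m0').
  have pp : prime p by apply: pdiv_prime.
  (* A homomorphism with values in p A could be divided by p, against
     minimality. *)
  have nondiv (c d : A) (h k : {additive A -> A}) j : (0 < j)%N -> (p %| j)%N ->
      (forall i, Q c d i -> (j <= i)%N) -> k c = c -> h c = d *+ j ->
      exists x, ~ exists y, h (k x) = y *+ p.
    move=> j0 pj minj kc hc; apply: contrapT => /forallNP all.
    have /choice[q qE] : forall x, exists y, h (k x) = y *+ p.
      by move=> x; apply: contrapT; apply: all.
    have p0 : p%:Z != 0 by case: (p) pp.
    have qB : zmod_morphism q.
      move=> x y; apply: (torsion_free_mulzI tfA p0) => /=.
      by rewrite -!pmulrn mulrnBl -!qE !raddfB.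
    have [q' q'E] := ex_additive qB.
    have : Q c d (j %/ p)%N.
      rewrite /Q divn_gt0 ?prime_gt0// dvdn_leq//; apply/asboolP; exists q'.
      apply: (torsion_free_mulzI tfA p0) => /=.
      by rewrite q'E -!pmulrn -qE kc hc -mulrnA divnK.
    by move=> /minj; rewrite leqNgt ltn_Pdiv// prime_gt1.
  have pm : (p %| m0)%N by rewrite (dvdn_trans (pdiv_dvd _))// dvdn_gcdl.
  have pm' : (p %| m0')%N by rewrite (dvdn_trans (pdiv_dvd _))// dvdn_gcdr.
  have [x xP] := nondiv _ _ f al _ m00 pm minm ala fa.
  have [x' xP'] := nondiv _ _ f' be _ m00' pm' minm' beb f'b.
  have [n [k [n0 wn]]] := dal x; have [n' [k' [n'0 wn']]] := dbe x'.
  have k0 : k != 0.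
    apply/eqP => k0; apply: xP; exists 0; move: wn; rewrite k0 mulr0z.
    by move/(torsion_free_mulz tfA n0) => ->; rewrite raddf0 mul0rn.
  have [m1 m1E] := dvdnP pm; have [m1' m1E'] := dvdnP pm'.
  have m10 : m1%:Z != 0 by case: (m1) m1E m00 => // ->.
  have K0 : m1%:Z * k * n' != 0 by rewrite !mulf_neq0.
  have [c [d [pd [e|e]]]] := cross_divide (m1'%:Z * k' * n) pp K0.
    case: xP'; apply: (divisible_value pp n0 n'0 wn wn' _ pd e).
    by rewrite f'b m1E' pmulrn PoszM.
  case: xP; apply: (divisible_value pp n'0 n0 wn' wn _ pd e).
  by rewrite fa m1E pmulrn PoszM.
have /coprimezP[[u v] /= uv] : coprimez m0 m0' by [].
have [s1 s1E] := ex_zscale (u * m0); have [s2 s2E] := ex_zscale u.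
have [s3 s3E] := ex_zscale (v * m0'); have [s4 s4E] := ex_zscale v.
(* The coefficients u m0 and v m0' are the elements of the ideals with sum
   1. *)
pose lam : {additive A -> A} :=
  ((s1 \o al) \+ (s2 \o (f \o al))) \+ ((s3 \o be) \+ (s4 \o (f' \o be))).
exists lam; split.
  rewrite /lam /= !raddfD ala alb beb bea !raddf0 !(add0r, addr0) fa f'b.
  rewrite s1E s2E s3E s4E !pmulrn -!mulrzA ![m0%:Z * _]mulrC ![m0'%:Z * _]mulrC.
  rewrite [X in _ + X]addrC -!mulrzDl.
  by rewrite -mulrzDr uv.
move=> x; apply: depD.
  have [n [k [n0 wn]]] := dal x; exists n, (k * (u * m0)); split=> //.
  rewrite /= s1E s2E !mulrzDl mulrzAC wn [_ *~ u *~ n]mulrzAC -raddfMz wn.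
  rewrite raddfMz fa pmulrn -!mulrzA; congr (_ + _ *~ _); ring.
have [n [k [n0 wn]]] := dbe x; exists n, (k * (v * m0')); split=> //.
rewrite /= s3E s4E !mulrzDl mulrzAC wn [_ *~ v *~ n]mulrzAC -raddfMz wn.
rewrite raddfMz f'b pmulrn -!mulrzA addrC; congr (_ *~ _ + _ *~ _); ring.
Qed.

End RankOne.

(** * Completely decomposable images of idempotents *)

Section CompletelyDecomposable.
Variable A : zmodType.
Hypothesis tfA : torsion_free A.

(** The subgroup generated by the pure subgroups of rank one that belong to
    the elements of [X]. If [X] is independent, it is their direct sum. *)
Inductive hull (X : set A) : A -> Prop :=
| hull_zero : hull X 0
| hull_add x w v : X x -> dep x w -> hull X v -> hull X (w + v).

Lemma hullD X v w : hull X v -> hull X w -> hull X (v + w).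
Proof.
elim=> [|x u v' Xx xu _ IH] Hw; first by rewrite add0r.
by rewrite -addrA; apply: hull_add Xx xu (IH Hw).
Qed.

Lemma hull_dep (X : set A) x w : X x -> dep x w -> hull X w.
Proof. by move=> Xx xw; rewrite -[w]addr0; apply: hull_add Xx xw (hull_zero X). Qed.

Lemma hull_hom (X Y : set A) (f : {additive A -> A}) v :
  (forall x, X x -> Y (f x)) -> hull X v -> hull Y (f v).
Proof.
move=> XY; elim=> [|x w v' Xx xw _ IH]; first by rewrite raddf0; constructor.
by rewrite raddfD; apply: (hull_add (XY _ Xx)) IH; apply: dep_hom.
Qed.

Lemma sub_hull (X Y : set A) v : X `<=` Y -> hull X v -> hull Y v.
Proof. by move=> XY; apply: (@hull_hom X Y idfun). Qed.

Lemma hull_id (X : set A) (f : {additive A -> A}) v :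
  (forall x, X x -> f x = x) -> hull X v -> f v = v.
Proof.
move=> fX; elim=> [|x w v' Xx xw _ IH]; first by rewrite raddf0.
by rewrite raddfD IH (dep_hom_id tfA xw (fX _ Xx)).
Qed.

Lemma independent0 : independent (set0 : set A).
Proof. by move=> s c _ s0 _ x /s0. Qed.

Lemma independent1 (x : A) : x != 0 -> independent [set x].
Proof.
move=> x0 s c us sx; have [->|[y ys]] : s = [::] \/ exists y, y \in s.
    by case: (s) => [|y ?]; [left|right; exists y; rewrite mem_head].
  by [].
have yx : y = x by apply: sx.
rewrite (bigD1_seq y)//= big_seq_cond big1 ?addr0; last first.
  move=> z /andP[/sx /= -> xy]; by rewrite yx eqxx in xy.
move=> cy z /sx ->; apply/eqP; apply: contraNT x0 => cx.
by rewrite yx in cy; rewrite (torsion_free_mulz tfA cx cy).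
Qed.

Lemma independent_family (J : Type) (Y : J -> set A) (e : J -> {additive A -> A}) :
  (forall j, independent (Y j)) -> (forall j y, Y j y -> e j y = y) ->
  (forall j k y, j <> k -> Y k y -> e j y = 0) ->
  independent (\bigcup_j Y j).
Proof.
move=> indY eY e0 s c us sY sum0 x xs; have [j _ Yjx] := sY x xs.
have := congr1 (e j) sum0; rewrite raddf0 raddf_sum /= => sum0j.
have : \sum_(y <- [seq y <- s | `[< Y j y >]]) y *~ c y = 0.
  rewrite -[RHS]sum0j big_filter big_mkcond /= [LHS]big_seq [RHS]big_seq.
  apply: eq_bigr => y ys; rewrite raddfMz.
  have [Yjy|Yjy] := pselect (Y j y); first by rewrite asboolT// eY.
  have [k _ Yky] := sY y ys; rewrite asboolF// (e0 j k) ?mul0rz//.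
  by move=> jk; apply: Yjy; rewrite jk.
move=> /(indY j _ _ (filter_uniq _ us)); apply; last by rewrite mem_filter asboolT.
by move=> y /=; rewrite mem_filter => /andP[/asboolP].
Qed.

(** Modulo [X], the homomorphism [f] identifies [Y] with a subset of [Z]. *)
Lemma independent_union (X Y Z : set A) (f h : {additive A -> A}) :
  independent X -> (forall x, X x -> f x = 0) -> independent Z ->
  (forall y, Y y -> Z (f y) /\ h (f y) = y) -> independent (X `|` Y).
Proof.
move=> indX fX indZ fY s c us sXY sum0.
pose sY := [seq x <- s | ~~ `[< X x >]].
have sYY x : x \in sY -> Y x /\ x \in s.
  by rewrite mem_filter => /andP[/asboolPn nX xs]; case: (sXY x xs).
have cY0 x : x \in sY -> c x = 0.
  move=> xsY; have [Yx xs] := sYY x xsY; have [Zfx hfx] := fY x Yx.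
  rewrite -hfx; apply: (indZ [seq f y | y <- sY] (c \o h)).
  - rewrite map_inj_in_uniq ?filter_uniq// => y z /sYY[/fY[_ hy] _] /sYY[/fY[_ hz] _] e.
    by rewrite -hy -hz e.
  - by move=> _ /mapP[y /sYY[/fY[+ _] _] ->].
  - rewrite big_map big_filter big_mkcond.
    transitivity (f (\sum_(y <- s) y *~ c y)); last by rewrite sum0 raddf0.
    rewrite raddf_sum /=.
    rewrite [LHS]big_seq [RHS]big_seq; apply: eq_bigr => y ys; rewrite raddfMz.
    case: asboolP => [/fX ->|Xy] /=; first by rewrite mul0rz.
    by have [|_ ->] := fY y; first by case: (sXY y ys).
  - exact: map_f.
move=> x xs; have [Xx|Xx] := pselect (X x); last first.
  by apply: cY0; rewrite mem_filter asboolF.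
have : \sum_(y <- [seq y <- s | `[< X y >]]) y *~ c y = 0.
  transitivity (\sum_(y <- s) y *~ c y); last by [].
  rewrite big_filter big_mkcond [LHS]big_seq [RHS]big_seq.
  apply: eq_bigr => y ys; case: asboolP => // Xy.
  by rewrite cY0 ?mulr0z// mem_filter asboolF.
move=> /(indX _ _ (filter_uniq _ us)); apply; last by rewrite mem_filter asboolT.
by move=> y /=; rewrite mem_filter => /andP[/asboolP].
Qed.

Lemma independent_chain (F : set (set A)) : (forall X, F X -> independent X) ->
  total_on F subset -> independent (\bigcup_(X in F) X).
Proof.
move=> indF Ftot s c us sF sum0 x xs.
have [X FX sX] : exists2 X, F X & [set` s] `<=` X.
  have [X0 FX0 _] := sF x xs.
  elim: s sF {us sum0 xs} => [|y s IH] sF; first by exists X0.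
  have [|X FX sX] := IH; first by move=> z zs; apply: sF; rewrite /= inE zs orbT.
  have [Y FY Yy] := sF y (mem_head y s).
  have [XY|YX] := Ftot _ _ FX FY.
    by exists Y => // z; rewrite /= inE => /predU1P[->|/sX/XY].
  by exists X => // z; rewrite /= inE => /predU1P[->|/sX]//; apply: YX.
exact: (indF X FX s c us sX sum0).
Qed.

(** The image of [e] is completely decomposable, with [X] choosing one
    nonzero element in each rank one summand. *)
Definition cd_idempotent (e : {additive A -> A}) : Prop := exists X : set A,
  [/\ independent X, forall a, hull X (e a) & forall x, X x -> e x = x].

Lemma cd_idempotent0 : cd_idempotent \0.
Proof. by exists set0; split=> //; [apply: independent0|constructor]. Qed.

Lemma cd_idempotentK e a : cd_idempotent e -> e (e a) = e a.
Proof. by move=> [X [_ Xe eX]]; apply: (hull_id eX). Qed.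

Lemma cd_idempotentD (e e' : {additive A -> A}) :
  cd_idempotent e -> cd_idempotent e' -> (forall a, e (e' a) = 0) ->
  (forall a, e' (e a) = 0) -> cd_idempotent (e \+ e').
Proof.
move=> [X [indX Xe eX]] [X' [indX' Xe' eX']] ee' e'e.
exists (X `|` X'); split.
- apply: (independent_union (Z := X') (f := e') (h := idfun)) => //.
    by move=> x /eX <-.
  by move=> y X'y; rewrite eX'.
- move=> a; apply: hullD; first exact: sub_hull (Xe a).
  exact: sub_hull (Xe' a).
- move=> x [Xx|Xx] /=; first by rewrite -{2}(eX x Xx) e'e addr0 eX.
  by rewrite -{1}(eX' x Xx) ee' add0r eX'.
Qed.

End CompletelyDecomposable.

(** * Decompositions into groups of rank one *)

(** [A] is the direct sum of the images of the [rho i], each contained in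
    the pure subgroup generated by [b i]. The summand is zero if [b i] is
    zero, so that summands of rank zero are covered as well. *)
Record rank1_decomposition (A : zmodType) (I : eqType)
    (rho : I -> {additive A -> A}) (b : I -> A) : Prop := Rank1Decomposition {
  rhoK : forall i x, rho i (rho i x) = rho i x;
  rho_orth : forall i j x, i != j -> rho i (rho j x) = 0;
  rho_sum : forall x, exists s, uniq s /\ x = \sum_(i <- s) rho i x;
  rho_dep : forall i x, dep (b i) (rho i x) }.

Section Decomposition.
Variables (A : zmodType) (I : eqType).
Hypothesis tfA : torsion_free A.
Variables (rho : I -> {additive A -> A}) (b : I -> A).
Hypothesis dec : rank1_decomposition rho b.

Lemma rho_notin x (s : seq I) : x = \sum_(i <- s) rho i x ->
  forall i, i \notin s -> rho i x = 0.
Proof.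
move=> xE i iNs; rewrite xE raddf_sum big_seq big1// => j js.
by rewrite (rho_orth dec)//; apply: contraNneq iNs => ->.
Qed.

Lemma rho_ext x y : (forall i, rho i x = rho i y) -> x = y.
Proof.
move=> xy; apply/subr0_eq; have [s [_ ->]] := rho_sum dec (x - y).
by rewrite big1// => i _; rewrite raddfB xy subrr.
Qed.

Lemma rho_dep2 i x y : rho i x != 0 -> dep (rho i x) (rho i y).
Proof.
move=> xi; apply: dep_trans (rho_dep dec i y).
by apply: (dep_sym tfA) => //; apply: rho_dep.
Qed.

(** The projection onto the sum of the components with index in [J],
    characterized by its coordinates; all identities between such
    projections are then checked on coordinates. *)
Lemma ex_block (J : set I) : exists P : {additive A -> A}, forall i x,
  rho i (P x) = if `[< J i >] then rho i x else 0.
Proof.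
have /choice[P PE] : forall x, exists y, forall i,
    rho i y = if `[< J i >] then rho i x else 0.
  move=> x; have [s [us xE]] := rho_sum dec x.
  exists (\sum_(j <- s | `[< J j >]) rho j x) => i.
  rewrite raddf_sum /=; have [is_|iNs] := boolP (i \in s); last first.
    rewrite (rho_notin xE iNs) if_same big_seq_cond big1// => j /andP[js _].
    by rewrite (rho_orth dec)//; apply: contraNneq iNs => ->.
  rewrite big_mkcond (bigD1_seq i)//= big1 ?addr0.
    by case: ifP => // _; rewrite (rhoK dec).
  by move=> j ji; case: ifP => // _; rewrite (rho_orth dec)// eq_sym.
have PB : zmod_morphism P.
  move=> x y; apply: rho_ext => i; rewrite raddfB !PE raddfB.
  by case: ifP; rewrite ?subr0.
have [P' P'E] := ex_additive PB.
by exists P' => i x; rewrite P'E.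
Qed.

Definition block (J : set I) : {additive A -> A} := sval (cid (ex_block J)).

Lemma blockE J i x : rho i (block J x) = if `[< J i >] then rho i x else 0.
Proof. by rewrite /block; case: cid. Qed.

Lemma block_in (J : set I) i x : J i -> rho i (block J x) = rho i x.
Proof. by move=> Ji; rewrite blockE asboolT. Qed.

Lemma block_out (J : set I) i x : ~ J i -> rho i (block J x) = 0.
Proof. by move=> Ji; rewrite blockE asboolF. Qed.

Lemma block_id (J : set I) x : (forall i, ~ J i -> rho i x = 0) -> block J x = x.
Proof.
move=> x0; apply: rho_ext => i; have [Ji|Ji] := pselect (J i).
  exact: block_in.
by rewrite block_out// x0.
Qed.

Lemma blockI (J K : set I) x : block J (block K x) = block (J `&` K) x.
Proof.
apply: rho_ext => i; have [Ji|Ji] := pselect (J i); last first.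
  by rewrite !block_out// => -[].
rewrite block_in//; have [Ki|Ki] := pselect (K i); first by rewrite !block_in.
by rewrite !block_out// => -[].
Qed.

Lemma blockK J x : block J (block J x) = block J x.
Proof. by rewrite blockI setIid. Qed.

Lemma block_disjoint (J K : set I) x : (forall i, J i -> ~ K i) ->
  block J (block K x) = 0.
Proof.
move=> JK; rewrite blockI; apply: rho_ext => i.
by rewrite block_out ?raddf0// => -[/JK].
Qed.

Lemma blockC J x : x = block J x + block (~` J) x.
Proof.
apply: rho_ext => i; rewrite raddfD; have [Ji|Ji] := pselect (J i).
  by rewrite block_in// block_out ?addr0//; apply.
by rewrite block_out// block_in// add0r.
Qed.

Lemma rho_blockE i x : rho i x = block [set i] x.
Proof.
apply: rho_ext => j; have [->|ji] := eqVneq j i.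
  by rewrite (rhoK dec) block_in.
by rewrite (rho_orth dec)// block_out// => /eqP; apply/negP.
Qed.

Lemma rho_support (J : set I) x : (forall i, J i -> rho i x = 0) -> block J x = 0.
Proof.
move=> x0; apply: rho_ext => i; have [Ji|Ji] := pselect (J i).
  by rewrite block_in// x0// raddf0.
by rewrite block_out// raddf0.
Qed.

Lemma block_vanish (J K : set I) (f : {additive A -> A}) :
  (forall i j x, J i -> K j -> rho j (f (rho i x)) = 0) ->
  forall x, block K (f (block J x)) = 0.
Proof.
move=> f0 x; apply: rho_support => j Kj.
have [s [_ ->]] := rho_sum dec (block J x).
rewrite !raddf_sum big1// => i _.
have [Ji|Ji] := pselect (J i); first by rewrite f0.
by rewrite block_out// !raddf0.
Qed.

(** ** The types of the components *)

(** Homomorphisms between components are zero or injective, so this is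
    transitive; it compares the types of the components. It is reflexive at
    nonzero components only. *)
Definition hom_le i j : Prop :=
  exists (f : {additive A -> A}) x, rho j (f (rho i x)) != 0.

Lemma hom_leP i j (f : {additive A -> A}) x :
  ~ hom_le i j -> rho j (f (rho i x)) = 0.
Proof.
move=> nij; apply/eqP; apply: contraT => f0; case: nij.
by exists f, x.
Qed.

Lemma hom_nonzero i (f : {additive A -> A}) x y : f (rho i x) != 0 ->
  rho i y != 0 -> f (rho i y) != 0.
Proof.
move=> fx yi; apply: contraNneq fx => fy.
by rewrite (dep_hom0 tfA (rho_dep2 _ yi) fy).
Qed.

Lemma hom_le_trans i j k : hom_le i j -> hom_le j k -> hom_le i k.
Proof.
move=> [f [x fx]] [g [y gy]]; exists (g \o (rho j \o f)), x => /=.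
have := @hom_nonzero j (rho k \o g) y (f (rho i x)) gy fx.
by [].
Qed.

Definition type_class t : set I := [set j | hom_le t j /\ hom_le j t].

(** A nonzero homomorphism from one component of type [t] to another one
    that factors through a component forces the latter to have type [t] as
    well. So taking the part of type [t] is multiplicative on endomorphisms;
    in particular it preserves idempotents. *)
Lemma type_class_comp t (f g : {additive A -> A}) x :
  let pt := block (type_class t) in
  pt (f (g (pt x))) = pt (f (pt (g (pt x)))).
Proof.
move=> pt; set w := g (pt x).
pose J := [set i | ~ type_class t i /\ hom_le t i].
pose J' := [set i | ~ type_class t i /\ ~ hom_le t i].
have -> : w = pt w + block J w.
  have J'0 : block J' w = 0.
    apply: block_vanish => k i y [tk kt] [_ nti].
    by apply: hom_leP => ki; apply: nti; apply: hom_le_trans ki.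
  apply: rho_ext => i; rewrite raddfD.
  have [ti|ti] := pselect (type_class t i).
    by rewrite [X in _ = X + _]block_in// block_out ?addr0// => -[].
  rewrite [X in _ = X + _]block_out// add0r.
  have [tli|tli] := pselect (hom_le t i); first by rewrite block_in.
  rewrite [RHS]block_out; last by case.
  by rewrite -(@block_in J')// J'0 raddf0.
have ptJ : pt (block J w) = 0 by apply: block_disjoint => i ti [].
have ptfJ : pt (f (block J w)) = 0.
  apply: block_vanish => i j y [nti ti] [tj jt].
  by apply: hom_leP => ij; apply: nti; split=> //; apply: hom_le_trans jt.
by rewrite !raddfD !blockK ptJ ptfJ !raddf0 !addr0.
Qed.

(** Baer's lemma. The components of [z] are added one at a time: if [z']
    generates a direct summand of type [t], so does the sum of [z'] and an
    element of another component of type [t], by the case of two summands. *)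
Lemma homogeneous_retract t z : (forall i, ~ type_class t i -> rho i z = 0) ->
  z != 0 -> exists lam : {additive A -> A}, lam z = z /\ forall x, dep z (lam x).
Proof.
move=> zt z0; have [s [us zE]] := rho_sum dec z.
have {zt} st : forall i, i \in [seq i <- s | rho i z != 0] ->
    type_class t i /\ rho i z != 0.
  move=> i; rewrite mem_filter => /andP[zi _]; split=> //.
  by apply: contrapT => /zt zi0; rewrite zi0 eqxx in zi.
have {zE} : z = \sum_(i <- [seq i <- s | rho i z != 0]) rho i z.
  rewrite big_filter {1}zE [RHS]big_mkcond; apply: eq_bigr => i _.
  by case: ifPn => // /negPn/eqP.
have {us} : uniq [seq i <- s | rho i z != 0] by rewrite filter_uniq.
move: [seq i <- s | _] st => l st; elim: l z z0 st => {s} [z z0 _ _|i s IH z z0 st /= /andP[is_ us]].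
  by rewrite big_nil => z00; rewrite z00 eqxx in z0.
rewrite big_cons => zE.
have [ti zi] := st _ (mem_head i s).
pose z' := \sum_(j <- s) rho j z.
have rz' j : j \in s -> rho j z' = rho j z.
  move=> js; rewrite zE raddfD (rho_orth dec) ?add0r// -/z'.
  by apply: contraNneq is_ => <-.
have iz' : rho i z' = 0.
  rewrite raddf_sum big_seq big1// => j js.
  by rewrite (rho_orth dec)//; apply: contraNneq is_ => ->.
have iz : rho i (rho i z) = rho i z by rewrite (rhoK dec).
have [s0|[j js]] : s = [::] \/ exists j, j \in s.
    by case: (s) => [|j s']; [left|right; exists j; rewrite mem_head].
  exists (rho i); rewrite {1 2}zE s0 big_nil addr0 iz; split=> // x.
  rewrite zE s0 big_nil addr0; exact: rho_dep2.
have [tj zj] := st j (mem_behead (s := i :: s) js).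
have z'0 : z' != 0.
  by apply: contraNneq zj => z'0; rewrite -rz'// z'0 raddf0.
have [|||lam' [lamz' lamd]] := IH z' z'0.
- move=> k ks; have [tk zk] := st k (mem_behead (s := i :: s) ks).
  by rewrite rz'.
- exact: us.
- by rewrite {1}/z' !big_seq; apply: eq_bigr => k ks; rewrite rz'.
have zE' : z = z' + rho i z by rewrite addrC.
have pz' : block (~` [set i]) z' = z'.
  by apply: block_id => k /contrapT ->.
have pzi x : block (~` [set i]) (rho i x) = 0.
  by apply: rho_support => k ki; rewrite (rho_orth dec)//; apply/eqP.
have [k ks lamk] : exists2 k, k \in s & lam' (rho k z) != 0.
  apply: contrapT => nk; case/eqP: z'0; rewrite -lamz' raddf_sum big_seq big1//.
  by move=> k ks; apply/eqP; apply: contraT => lk; case: nk; exists k.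
have [tk zk] := st k (mem_behead (s := i :: s) ks).
have [f [x fx]] : hom_le j i by apply: hom_le_trans ti.1; case: tj.
have [g [y gy]] : hom_le i k by apply: hom_le_trans tk.1; case: ti.
have gz : rho k (g (rho i z)) != 0 := @hom_nonzero i (rho k \o g) _ _ gy zi.
have lamg : lam' (rho k (g (rho i z))) != 0 := hom_nonzero lamk gz.
rewrite zE'; apply: (@diagonal_retract A tfA _ _ (lam' \o block (~` [set i]))
  (rho i) (rho i \o f \o rho j) (lam' \o rho k \o g)) => //=.
- by rewrite pz'.
- by rewrite pzi raddf0.
- by move=> w; apply: rho_dep2.
- by rewrite rz'//; apply: (@hom_nonzero j (rho i \o f) _ _ fx zj).
- exact: rho_dep2.
Qed.

(** * The Baer-Kulikov-Kaplansky theorem *)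

Lemma ex_maximal (s : seq I) : s != [::] ->
  exists2 t, t \in s & forall j, j \in s -> hom_le t j -> hom_le j t.
Proof.
elim: s => [//|j s IH] _; have [s0|sn0] := eqVneq s [::].
  by exists j => [|k]; rewrite s0 inE// => /eqP ->.
have [t ts maxt] := IH sn0.
have [tj|ntj] := pselect (hom_le t j); last first.
  exists t; first by rewrite inE ts orbT.
  by move=> k; rewrite inE => /predU1P[-> /ntj|/maxt].
exists j; first by rewrite mem_head.
move=> k; rewrite inE => /predU1P[->//|ks jk].
exact: hom_le_trans (maxt k ks (hom_le_trans tj jk)) tj.
Qed.

(** The image of [pi] is compared with the sum [A_s] of the components whose
    type occurs in [s] by homomorphisms [u] and [v] such that [u v] fixes
    [x]. Neither [u v] nor [v u] need be idempotent, but on the part of each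
    type [v u] is. This is what makes the induction on the number of types
    work. A maximal type [t] in [s] is respected by all endomorphisms of
    [A_s]. Hence if the part [z] of [v x] in the image of [v u] on type [t]
    is nonzero, the pure subgroup that it generates is isomorphic, along
    [u], to a direct summand of the image of [pi]. After its removal the
    type [t] is no longer needed to reach [x]. *)
Lemma peel_types n (s : seq I) (pi u v : {additive A -> A}) x :
  (size s <= n)%N ->
  (forall a, pi (pi a) = pi a) -> (forall a, pi (u a) = u a) ->
  (forall a i, (forall t, t \in s -> ~ type_class t i) -> rho i (v a) = 0) ->
  (forall t, t \in s -> forall a, let p := block (type_class t) in
     p (v (u (p (v (u (p a)))))) = p (v (u (p a)))) ->
  pi x = x -> u (v x) = x ->
  exists e, [/\ cd_idempotent e, forall a, pi (e a) = e a,
    forall a, e (pi a) = e a & e x = x].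
Proof.
elim: n s pi u v x => [|n IH] s pi u v x sn piK piu vs grad pix uvx.
  exists \0; split=> //; [exact: cd_idempotent0|by move=> a; rewrite raddf0|].
  rewrite -uvx (_ : v x = 0) ?raddf0//.
  apply: (rho_ext) => i; rewrite raddf0; apply: vs => t.
  by move: sn; rewrite leqn0 size_eq0 => /eqP ->.
have [s0|sn0] := eqVneq s [::]; first by apply: (IH s pi u v x) => //; rewrite s0.
have [t ts maxt] := ex_maximal sn0.
pose p := block (type_class t); pose et a := v (u (p a)).
have pet a : p (et a) = et a.
  apply: block_id => j nj; rewrite /et.
  have [[j0 j0s j0j]|nj0] := pselect (exists2 j0, j0 \in s & type_class j0 j).
    rewrite (rho_blockE); apply: (block_vanish (f := v \o u)) => i _ w ti ->.
    apply: hom_leP => ij; apply: nj.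
    have tj : hom_le t j by apply: hom_le_trans ti.1 ij.
    split=> //; apply: hom_le_trans j0j.2 _; apply: maxt => //.
    exact: hom_le_trans tj j0j.2.
  by apply: vs => j0 j0s j0j; apply: nj0; exists j0.
have eet a : et (et a) = et a.
  by have : p (et (et a)) = p (et a) := grad t ts a; rewrite !pet.
(* Unlike u, the map u v u vanishes on the kernel of v u on type t. *)
pose u1 : {additive A -> A} := u \o v \o u.
have u1E a : u1 a = u (v (u a)) by [].
have vu1 w : p w = w -> v (u1 w) = et w.
  move=> pw; rewrite u1E (_ : v (u w) = et w); last by rewrite /et pw.
  by rewrite -[et w in LHS]pet; apply: eet.
pose s' := [seq j <- s | (j != t) && ~~ `[< type_class t j >]].
have s'n : (size s' <= n)%N.
  rewrite -ltnS; apply: leq_trans sn; rewrite /s' size_filter.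
  rewrite -(count_predC (fun j => (j != t) && ~~ `[< type_class t j >]) s).
  rewrite -addn1 leq_add2l -has_count; apply/hasP; exists t => //=.
  by rewrite eqxx.
pose q := block (~` type_class t).
pose v' : {additive A -> A} := q \o v.
have v's' a i : (forall t, t \in s' -> ~ type_class t i) -> rho i (v' a) = 0.
  move=> nti; rewrite /v' /= /q.
  have [ti|ti] := pselect (type_class t i).
    by rewrite block_out//; apply.
  rewrite block_in//; apply: vs => j js ji; apply: (nti j) => //.
  rewrite mem_filter js andbT; apply/andP; split.
    by apply: contra_notN ti => /eqP <-.
  apply/asboolP => tj; apply: ti; split.
    exact: hom_le_trans tj.1 ji.1.
  exact: hom_le_trans ji.2 tj.2.
have s'P j : j \in s' -> j \in s /\ forall i, type_class j i -> ~ type_class t i.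
  rewrite mem_filter => /andP[/andP[_ /asboolPn ntj] js]; split=> // i ji ti.
  apply: ntj; split; first exact: hom_le_trans ti.1 ji.2.
  exact: hom_le_trans ji.1 ti.2.
have qj j a : j \in s' -> block (type_class j) (q a) = block (type_class j) a.
  move=> /s'P[_ jt]; rewrite /q blockI; congr (block _ _).
  by apply/seteqP; split=> [i []|i ji]//; split=> //; apply: jt.
have pj j a : j \in s' -> block (type_class j) (p a) = 0.
  by move=> /s'P[_ jt]; apply: block_disjoint.
have qp a : q (p a) = 0 by apply: block_disjoint.
have qE a : q a = a - p a by rewrite [a in a - _](blockC (type_class t)) addrAC subrr add0r.
have grad1 j : j \in s' -> forall a, let pj := block (type_class j) in
    pj (v (u1 (pj a))) = pj (v (u (pj a))).
  move=> /s'P[js _] a pj0.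
  have := type_class_comp j (v \o u) (v \o u) a.
  rewrite /= -/pj0 => ->; exact: grad.
pose y := v x; pose z := et y.
have u1y : u1 y = x by rewrite u1E /y !uvx.
have u1p a : u1 (p a) = u (et a) by rewrite u1E.
have [z0|z0] := eqVneq z 0.
  apply: (IH s' pi u1 v') => //.
  - by move=> a; rewrite u1E piu.
  - move=> j js' a pj0; rewrite /v' /= !qj// !grad1//; apply: grad.
    by case: (s'P j js').
  - have -> : v' x = y - p y by rewrite -qE.
    by rewrite raddfB u1y u1p -/z z0 raddf0 subr0.
have pz : p z = z by apply: pet.
have ez : et z = z by apply: eet.
have [lam [lamz lamd]] : exists lam : {additive A -> A}, lam z = z /\
    forall a, dep z (lam a).
  by apply: (homogeneous_retract (t := t)) => // i ti; rewrite -pz block_out.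
pose ez' : {additive A -> A} := v \o u \o p.
have fixdep w : dep z w -> [/\ p w = w, et w = w & lam w = w].
  move=> zw; split; first exact: (dep_hom_id tfA zw pz).
    exact: (dep_hom_id tfA (f := ez') zw ez).
  exact: (dep_hom_id tfA zw lamz).
(* The image of e is the image under u1 of the pure subgroup generated by z. *)
pose e : {additive A -> A} := u1 \o lam \o ez' \o v \o pi.
have eE a : e a = u1 (lam (et (v (pi a)))) by [].
have piu1 a : pi (u1 a) = u1 a by rewrite u1E piu.
have eu1 w : dep z w -> e (u1 w) = u1 w.
  move=> zw; have [pw ew lw] := fixdep w zw.
  by rewrite eE piu1 vu1// !ew lw.
have cde : cd_idempotent e.
  exists [set u1 z]; split.
  - apply: (independent1 tfA); apply: contraNneq z0 => u1z.
    by rewrite -ez -vu1// u1z raddf0.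
  - move=> a; apply: (@hull_dep _ _ (u1 z)) => //; rewrite eE.
    exact: dep_hom.
  - by move=> _ ->; apply: eu1; apply: dep_refl.
have epi a : e (pi a) = e a by rewrite !eE piK.
have pie a : pi (e a) = e a by rewrite eE piu1.
have ex : e x = u1 z by rewrite eE pix -/y -/z lamz.
have eK a : e (e a) = e a by apply: cd_idempotentK.
pose pi' : {additive A -> A} := pi \- e.
have pi'E a : pi' a = pi a - e a by [].
pose x' := pi' x.
have pi'K a : pi' (pi' a) = pi' a.
  by rewrite !pi'E (raddfB pi) (raddfB e) piK pie epi eK subrr subr0.
have pi'u1 w : dep z w -> pi' (u1 w) = 0.
  by move=> zw; rewrite pi'E piu1 eu1// subrr.
have ve a : dep z (v (e a)).
  rewrite eE; have [pw ew lw] := fixdep _ (lamd (et (v (pi a)))).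
  by rewrite vu1// ew.
have [|||||e' [cde' pie' epi' ex']] :=
  IH s' pi' (pi' \o u1) v' x' s'n pi'K.
- by move=> a; apply: pi'K.
- exact: v's'.
- move=> j js' a pj0.
  have red w : pj0 (v' ((pi' \o u1) w)) = pj0 (v (u1 w)).
    rewrite -[v' _]/(q (v (pi' (u1 w)))) qj// pi'E piu1 (raddfB v) (raddfB pj0).
    have [<- _ _] := fixdep _ (ve (u1 w)).
    by rewrite [pj0 (p _)]pj// subr0.
  rewrite !red !grad1//; apply: grad; by case: (s'P j js').
- exact: pi'K.
- have vx' : v x' = y - z.
    by rewrite /x' pi'E pix ex raddfB vu1// ez.
  rewrite -[LHS]/(pi' (u1 (q (v x')))) vx' (raddfB q).
  have -> : q z = 0 by rewrite -pz qp.
  rewrite subr0 qE (raddfB u1) u1y u1p -/z.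
  have -> : u z = u1 z by rewrite u1E -{1}ez /et pz.
  by rewrite (raddfB pi') pi'u1 ?subr0//; apply: dep_refl.
have ee' a : e (e' a) = 0.
  by rewrite -pie' pi'E (raddfB e) epi eK subrr.
have e'e a : e' (e a) = 0.
  by rewrite -epi' pi'E pie eK subrr raddf0.
exists (e \+ e'); split.
- exact: cd_idempotentD.
- move=> a; rewrite -[LHS]/(pi (e a + e' a)) raddfD pie; congr (_ + _).
  by rewrite -{1}pie' pi'E (raddfB pi) piK pie -pi'E pie'.
- move=> a; rewrite -[LHS]/(e (pi a) + e' (pi a)) epi; congr (_ + _).
  by rewrite -epi' pi'E piK epi -pi'E epi'.
- rewrite -[LHS]/(e x + e' x) -[e' x]epi' ex' /x' pi'E pix.
  by rewrite addrC subrK.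
Qed.

(** Every element of the image of [pi] lies in a completely decomposable
    direct summand of that image: the inclusion and the projection onto the
    types in its support satisfy the assumptions of [peel_types]. *)
Lemma cd_peel (pi : {additive A -> A}) x : (forall a, pi (pi a) = pi a) ->
  exists e, [/\ cd_idempotent e, forall a, pi (e a) = e a,
    forall a, e (pi a) = e a & e (pi x) = pi x].
Proof.
move=> piK; have [s [us sE]] := rho_sum dec (pi x).
pose U : set I := [set i | exists2 t, t \in s & type_class t i].
have le_refl i w : rho i w != 0 -> type_class i i.
  by move=> wi; split; exists idfun, w; rewrite /= (rhoK dec).
have Ux : block U (pi x) = pi x.
  apply: block_id => i Ui; apply/eqP; apply: contraT => xi.
  case: Ui; exists i; last exact: le_refl xi.
  by apply: contraNT xi => iNs; rewrite (rho_notin sE).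
apply: (@peel_types (size s) s pi pi (block U)) => //.
- by move=> a i nt; rewrite block_out// => -[t ts ti]; apply: (nt t).
- move=> t ts a /=.
  have UE w : block (type_class t) (block U w) = block (type_class t) w.
    rewrite blockI; congr (block _ _).
    by apply/seteqP; split=> [i []|i ti]//; split=> //; exists t.
  by rewrite !UE -(type_class_comp) piK.
- by rewrite Ux.
Qed.

(** Summands enclosing the elements of a sequence are split off one after
    the other. They exhaust the image of [pi] if an endomorphism that
    factors through [pi] and kills the sequence is zero, pointwise after
    finitely many terms. *)
Lemma cd_countable (pi : {additive A -> A}) (en : nat -> A) :
  (forall a, pi (pi a) = pi a) ->
  (forall a, exists N, forall f : {additive A -> A},
     (forall w, f (pi w) = f w) -> (forall n, (n < N)%N -> f (en n) = 0) ->
     f a = 0) ->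
  cd_idempotent pi.
Proof.
move=> piK gen.
have /choice[F FP] : forall qx : {additive A -> A} * A,
    exists e : {additive A -> A}, (forall a, qx.1 (qx.1 a) = qx.1 a) ->
    [/\ cd_idempotent e, forall a, qx.1 (e a) = e a,
      forall a, e (qx.1 a) = e a & e (qx.1 qx.2) = qx.1 qx.2].
  move=> [q x] /=; have [qK|qK] := pselect (forall a, q (q a) = q a).
    by have [e eP] := cd_peel x qK; exists e.
  by exists \0.
pose P n : {additive A -> A} := iteri n (fun m (q : {additive A -> A}) =>
  q \- F (q, en m) : {additive A -> A}) pi.
pose e n := F (P n, en n).
have PS n a : P n.+1 a = P n a - e n a by [].
have PK n a : P n (P n a) = P n a.
  elim: n a => [|n IH] a; first exact: piK.
  have [ce Pe eP _] := FP (P n, en n) IH.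
  by rewrite !PS (raddfB (P n)) (raddfB (e n)) IH Pe eP (cd_idempotentK tfA _ ce)
    subrr subr0.
have eP n : [/\ cd_idempotent (e n), forall a, P n (e n a) = e n a,
    forall a, e n (P n a) = e n a & e n (P n (en n)) = P n (en n)].
  by apply: (FP (P n, en n)); apply: PK.
have eK n a : e n (e n a) = e n a by apply: (cd_idempotentK tfA); case: (eP n).
have Ple m n a : (m <= n)%N -> P m (P n a) = P n a /\ P n (P m a) = P n a.
  move=> mn; rewrite -(subnKC mn); elim: (n - m)%N a => [|k IH] a.
    by rewrite addn0 PK.
  have [_ Pe ePa _] := eP (m + k)%N.
  rewrite addnS !PS (raddfB (P m)); have [-> PP] := IH a.
  rewrite PP; split; first by rewrite -{1}Pe (proj1 (IH _)) Pe.
  by rewrite -[in LHS]ePa PP ePa.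
have PSe n a : P n.+1 (e n a) = 0.
  by rewrite PS; have [_ -> _ _] := eP n; rewrite eK subrr.
have eorth m n a : m <> n -> e m (e n a) = 0.
  move=> mNn; have [_ Pem ePm _] := eP m; have [_ Pen ePn _] := eP n.
  have [mn|nm] : (m < n)%N \/ (n < m)%N by lia.
    rewrite -Pen -(proj1 (Ple _ _ _ mn)) PS (raddfB (e m)) ePm eK.
    by rewrite subrr.
  by rewrite -ePm -(proj2 (Ple _ _ _ nm)) PSe !raddf0.
have /choice[X XP] : forall n, exists X, [/\ independent X,
  forall a, hull X (e n a) & forall x, X x -> e n x = x].
  by move=> n; case: (eP n).
exists (\bigcup_n X n); split.
- apply: (independent_family (e := e)) => [n|n y Xy|m n y mn Xy].
  + by case: (XP n).
  + by case: (XP n) => _ _; apply.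
  + by have [_ _ /(_ y Xy) <-] := XP n; apply: eorth.
- move=> a; have [N /(_ (P N))] := gen a.
  move=> aN; have PNa : P N a = 0.
    apply: aN => [w|n nN]; first exact: (proj2 (Ple 0%N N w (leq0n N))).
    rewrite -(proj2 (Ple _ _ _ nN)) PS -[e n (en n)](_ : P n (en n) = _).
      by rewrite subrr raddf0.
    by have [_ _ ePn ePne] := eP n; rewrite -ePne ePn.
  suff : hull (\bigcup_n X n) (pi a - P N a) by rewrite PNa subr0.
  elim: N {aN PNa} => [|n IH]; first by rewrite subrr; constructor.
  rewrite PS opprB addrCA; apply: hullD => //.
  have [_ Xe _] := XP n; apply: sub_hull (Xe a); exact: bigcup_sup.
- move=> x [n _ Xx]; have [_ _ /(_ x Xx) <-] := XP n.
  have [_ Pen _ _] := eP n; rewrite -Pen.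
  exact: (proj1 (Ple 0%N n _ (leq0n n))).
Qed.

(** Kaplansky's argument. [J] is a set of components with a [pi]-invariant
    sum, for which a decomposition of the image of [pi] is known. Closing
    [i0] under the supports of the images of components adds a countable set
    [K] of components. Modulo the components in [J], [pi] induces an
    idempotent of the sum of the components in [K], whose image is
    completely decomposable by the countable case, and [pi] itself maps this
    image back to a complement of the known part. *)
Lemma cd_invariant_extend (pi : {additive A -> A}) (J : set I) (X : set A) i0 :
  (forall a, pi (pi a) = pi a) ->
  (forall i l w, J i -> ~ J l -> rho l (pi (rho i w)) = 0) ->
  independent X ->
  (forall x, X x -> pi x = x /\ forall l, ~ J l -> rho l x = 0) ->
  (forall a, (forall l, ~ J l -> rho l a = 0) -> hull X (pi a)) ->
  exists (J' : set I) (X' : set A), [/\ J `<=` J', J' i0, X `<=` X' &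
  [/\ forall i l w, J' i -> ~ J' l -> rho l (pi (rho i w)) = 0,
  independent X',
  forall x, X' x -> pi x = x /\ forall l, ~ J' l -> rho l x = 0 &
  forall a, (forall l, ~ J' l -> rho l a = 0) -> hull X' (pi a)]].
Proof.
move=> piK invJ indX fixX spanX.
have /choice[N NP] : forall j, exists s : seq I, forall l w,
    l \notin s -> rho l (pi (rho j w)) = 0.
  move=> j; have [s [_ sE]] := rho_sum dec (pi (b j)).
  exists s => l w ls; apply: (dep_hom0 tfA (f := rho l \o pi) (rho_dep dec j w)).
  exact: (rho_notin sE ls).
pose level n := iter n (fun s : seq I => flatten [seq N j | j <- s]) [:: i0].
pose K0 : set I := [set i | exists n, i \in level n].
pose en m := let nk := odflt (0%N, 0%N) (unpickle m) in b (nth i0 (level nk.1) nk.2).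
have enP i : K0 i -> exists m, en m = b i.
  move=> [n iln]; exists (pickle (n, index i (level n))).
  by rewrite /en pickleK /= nth_index.
pose K : set I := K0 `\` J; pose J' := J `|` K0.
have J'P i : J' i -> J i \/ K i.
  by move=> [Ji|K0i]; [left|have [Ji|Ji] := pselect (J i); [left|right]].
have invJ' i l w : J' i -> ~ J' l -> rho l (pi (rho i w)) = 0.
  move=> [Ji|[n iln]] J'l; first by apply: invJ => // Jl; apply: J'l; left.
  apply: NP; apply/negP => lN; apply: J'l; right; exists n.+1.
  by apply/flattenP; exists (N i) => //; apply: map_f.
have clJ' a : (forall l, ~ J' l -> rho l a = 0) -> forall l, ~ J' l -> rho l (pi a) = 0.
  move=> a0 l J'l; rewrite -(block_id a0) (rho_blockE).
  by apply: (block_vanish) => i _ w J'i ->; apply: invJ'.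
have splitJ' a : (forall l, ~ J' l -> rho l a = 0) -> a = block J a + block K a.
  move=> a0; apply: (rho_ext) => i; rewrite raddfD.
  have [Ji|Ji] := pselect (J i).
    by rewrite [X in _ = X + _]block_in// block_out ?addr0// => -[].
  rewrite [X in _ = X + _]block_out// add0r.
  have [Ki|Ki] := pselect (K i); first by rewrite block_in.
  by rewrite block_out// a0// => /J'P[].
have KpiJ a : block K (pi (block J a)) = 0.
  by apply: (block_vanish) => i j w Ji [_ Jj]; apply: invJ.
have suppK a l : ~ J' l -> rho l (block K a) = 0.
  by move=> J'l; rewrite block_out// => -[K0l _]; apply: J'l; right.
pose piK' : {additive A -> A} := block K \o pi \o block K.
have piK'E a : piK' a = block K (pi (block K a)) by [].
have KpiK a : (forall l, ~ J' l -> rho l a = 0) -> block K (pi a) = piK' a.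
  by move=> /splitJ' aE; rewrite {1}aE (raddfD pi) (raddfD (block K)) KpiJ add0r.
have piK'K a : piK' (piK' a) = piK' a.
  rewrite [piK' a]piK'E; set w := pi (block K a).
  rewrite piK'E blockK -piK'E -KpiK ?piK//.
  by apply: clJ'; apply: suppK.
have [Xb [indXb spanXb fixXb]] : cd_idempotent piK'.
  apply: (cd_countable (en := en)) => // a.
  have [s [us sE]] := rho_sum dec (piK' a).
  have /choice[idx idxP] : forall i, exists m, K0 i -> en m = b i.
    by move=> i; have [/enP[m ?]|?] := pselect (K0 i); [exists m|exists 0%N].
  exists (\max_(i <- s) (idx i).+1)%N => f fpi fen.
  rewrite -fpi sE raddf_sum big_seq big1// => i is_.
  have [Ki|Ki] := pselect (K i); last by rewrite piK'E block_out// raddf0.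
  apply: (dep_hom0 tfA (rho_dep dec i _)).
  by rewrite -(idxP i Ki.1) fen//; apply: (@leq_bigmax_seq _ s xpredT).
have Xbfix x : Xb x -> block K x = x /\ block K (pi x) = x.
  move=> /fixXb xE; have Kx : block K x = x by rewrite -xE piK'E blockK.
  by split=> //; rewrite -{1}Kx -piK'E.
exists J', (X `|` pi @` Xb); split.
- by move=> i; left.
- by right; exists 0%N; rewrite inE.
- by move=> x; left.
split=> //.
- apply: (independent_union (Z := Xb) (f := block K) (h := pi)) => //.
    by move=> x /fixX[_ x0]; apply: (rho_support) => i [_ /x0].
  by move=> _ [x Xbx <-]; have [_ ->] := Xbfix x Xbx.
- move=> x [Xx|[y Yy <-]].
    have [pix x0] := fixX x Xx; split=> // l J'l.
    by apply: x0 => Jl; apply: J'l; left.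
  rewrite piK; split=> //; apply: clJ' => l J'l.
  by have [<- _] := Xbfix y Yy; apply: suppK.
- move=> a a0; pose w := pi a.
  have Kw : block K w = piK' a by apply: KpiK.
  rewrite -/w (_ : w = pi (block J w) + pi (block K w)); last first.
    by rewrite -raddfD -splitJ' ?piK//; apply: clJ'.
  apply: hullD; last first.
    rewrite Kw; apply: (hull_hom _ (spanXb a)) => x Xbx.
    by right; exists x.
  by apply: (sub_hull _ (spanX _ _)) => [x|l Jl]; [left|rewrite block_out].
Qed.

(** The Baer-Kulikov-Kaplansky theorem, by Zorn's lemma on pairs of a set of
    components and an independent set; such a pair is coded as a subset of
    the disjoint union. *)
Lemma cd_of_idempotent (pi : {additive A -> A}) :
  (forall a, pi (pi a) = pi a) -> cd_idempotent pi.
Proof.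
move=> piK.
pose JJ (Gam : set (I + A)) : set I := [set i | Gam (inl i)].
pose XX (Gam : set (I + A)) : set A := [set x | Gam (inr x)].
pose P (Gam : set (I + A)) := [/\
  forall i l w, JJ Gam i -> ~ JJ Gam l -> rho l (pi (rho i w)) = 0,
  independent (XX Gam),
  forall x, XX Gam x -> pi x = x /\ forall l, ~ JJ Gam l -> rho l x = 0 &
  forall a, (forall l, ~ JJ Gam l -> rho l a = 0) -> hull (XX Gam) (pi a)].
have P0 : P set0.
  split=> //; first exact: independent0.
  move=> a a0; rewrite (_ : a = 0) ?raddf0; first by constructor.
  by apply: (rho_ext) => i; rewrite a0 ?raddf0// => -[].
have [F [Gam1 FGam1] FP Ftot|Gam [_ [invG indG fixG spanG] maxG]] := Zorn_above P0.
  split.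
  - move=> i l w [Gam FG Gi] nl; have [inv _ _ _] := FP _ FG.
    by apply: inv => // Gl; apply: nl; exists Gam.
  - rewrite (_ : XX _ = \bigcup_(X in XX @` F) X); last first.
      apply/seteqP; split=> [x [Gam FG Gx]|x [_ [Gam FG <-] Gx]].
        by exists (XX Gam) => //; exists Gam.
      by exists Gam.
    apply: independent_chain => [_ [Gam FG <-]|_ _ [Gam FG <-] [Gam' FG' <-]].
      by case: (FP _ FG).
    by have [sub|sub] := Ftot _ _ FG FG'; [left|right] => x /sub.
  - move=> x [Gam FG Gx]; have [_ _ fix_ _] := FP _ FG.
    have [pix x0] := fix_ x Gx; split=> // l nl; apply: x0 => Gl; apply: nl.
    by exists Gam.
  - move=> a a0; have [s [_ sE]] := rho_sum dec a.
    have [Gam FG sG] : exists2 Gam, F Gam &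
        forall i, i \in s -> rho i a != 0 -> JJ Gam i.
      elim: s {sE} => [|i s [Gam FG sG]]; first by exists Gam1.
      have [ai|ai] := eqVneq (rho i a) 0.
        exists Gam => // j; rewrite inE => /predU1P[->|]; last exact: sG.
        by rewrite ai eqxx.
      have [Gam' FG' Gi] : (\bigcup_(X in F) X) (inl i : I + A).
        by apply: contrapT => nG; move: ai; rewrite a0 ?eqxx.
      have [sub|sub] := Ftot _ _ FG FG'.
        by exists Gam' => // j; rewrite inE => /predU1P[->//|js /(sG j js)/sub].
      exists Gam => // j; rewrite inE => /predU1P[->|]; last exact: sG.
      by move=> _; apply: sub.
    have [_ _ _ span] := FP _ FG.
    apply: (@sub_hull _ (XX Gam)) (span a _) => [x Gx|l Gl]; first by exists Gam.
    apply/eqP; apply: contraT => al; case: Gl; apply: sG => //.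
    by apply: contraNT al => ls; rewrite (rho_notin sE).
have allJ i : JJ Gam i.
  have [J' [X' [JJ' J'i XX' [inv' ind' fix' span']]]] :=
    cd_invariant_extend i piK invG indG fixG spanG.
  pose Gam' : set (I + A) := fun u => match u with inl j => J' j | inr x => X' x end.
  apply: (maxG Gam'); last exact: J'i; last by split.
  by move=> [j|x]; [apply: JJ'|apply: XX'].
exists (XX Gam); split=> // [a|x /fixG[]//].
by apply: spanG => l /(_ (allJ l)).
Qed.

End Decomposition.

(** * Completely decomposable groups *)

Lemma independent_neq0 (A : zmodType) (X : set A) x :
  independent X -> X x -> x != 0.
Proof.
move=> indX Xx; apply/eqP => x0.
have : {in [:: x], forall z, (1 : int) = 0}.
  apply: (indX [:: x] (fun=> 1)) => //; last by rewrite big_seq1 x0 mul0rz.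
  by move=> z; rewrite /= inE => /eqP ->.
by move=> /(_ x (mem_head _ _)).
Qed.

Lemma common_multiple (A : zmodType) (s : seq A) (d : A -> A) :
  (forall x, x \in s -> dep x (d x)) ->
  exists2 M : int, M != 0 & forall x, x \in s -> exists k : int, d x *~ M = x *~ k.
Proof.
elim: s => [|x s IH] ds; first by exists 1.
have [|M M0 sM] := IH; first by move=> y ys; apply: ds; rewrite inE ys orbT.
have [m [k [m0 dx]]] := ds x (mem_head x s).
exists (M * m); first by rewrite mulf_neq0.
move=> y; rewrite inE => /predU1P[->|/sM[l dy]].
  by exists (k * M); rewrite mulrC !mulrzA dx.
by exists (l * m); rewrite !mulrzA dy.
Qed.

(** Independence is about integral combinations, but by a common denominator
    it yields the directness of the sum of the pure subgroups of rank one. *)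
Lemma independent_dep (A : zmodType) (X : set A) (s : seq A) (d : A -> A) :
  torsion_free A -> independent X -> uniq s -> [set` s] `<=` X ->
  (forall x, x \in s -> dep x (d x)) -> \sum_(x <- s) d x = 0 ->
  forall x, x \in s -> d x = 0.
Proof.
move=> tfA indX us sX ds sum0 x xs.
have [M M0 sM] := common_multiple ds.
have /choice[k kP] : forall x, exists k : int, x \in s -> d x *~ M = x *~ k.
  by move=> y; have [/sM[k yk]|_] := boolP (y \in s); [exists k|exists 0].
apply: (torsion_free_mulz tfA M0); rewrite kP// (indX s k us sX) ?mulr0z//.
have [h hE] := ex_zscale A M.
transitivity (h (\sum_(y <- s) d y)); last by rewrite sum0 raddf0.
by rewrite raddf_sum !big_seq; apply: eq_bigr => y ys; rewrite hE kP.
Qed.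

(** Any larger independent set would contain an element that depends on [x]. *)
Lemma rank1_dep (A : zmodType) (x : A) : torsion_free A -> x != 0 ->
  (forall y, dep x y) -> has_torsion_free_rank A 1.
Proof.
move=> tfA x0 depx; exists [set x].
  split; first exact: independent1.
  move=> S' indS' xS'; apply/seteqP; split=> // y S'y.
  have xS'x : S' x by apply: xS'.
  apply: contrapT => /eqP yx; have [m [k [m0 yxm]]] := depx y.
  pose c z := if z == y then m else if z == x then - k else 0.
  have /(_ y) : {in [:: x; y], forall z, c z = 0}.
    apply: indS'.
    - by rewrite /= inE andbT eq_sym.
    - by move=> z; rewrite /= !inE => /orP[] /eqP ->.
    - have xy : (x == y) = false by rewrite eq_sym (negPf yx).
      by rewrite !big_cons big_nil addr0 /c !eqxx xy yxm mulrNz addNr.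
  by rewrite !inE eqxx orbT /c eqxx => /(_ isT)/eqP; rewrite (negPf m0).
exact: card_set1.
Qed.

(** If [y] did not depend on [x], adding it would enlarge the maximal
    independent set. *)
Lemma rank1_generator (A : zmodType) : torsion_free A ->
  has_torsion_free_rank A 1 -> exists2 x : A, x != 0 & forall y, dep x y.
Proof.
move=> tfA [S [indS maxS] /card_set_bijP[f [fS finj fsurj]]].
have [x Sx fx] : exists2 x, S x & f x = 0%N.
  by have /fsurj[x Sx fx] : (`I_1 : set nat) 0%N by []; exists x.
have SE : S = [set x].
  apply/seteqP; split=> [y Sy|_ -> //]; apply: finj; rewrite ?inE// fx.
  by have := fS _ Sy; rewrite /= ltnS leqn0 => /eqP.
have x0 : x != 0 by apply: (independent_neq0 indS).
exists x => // y; have [->|yx] := eqVneq y x; first exact: dep_refl.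
apply: contrapT => ndep.
have xyS : [set x; y] = S.
  apply: maxS; last by rewrite SE => z ->; left.
  move=> s c us sxy sum0.
  pose c' z := if z \in s then c z else 0.
  have xyE : x *~ c' x + y *~ c' y = 0.
    transitivity (\sum_(z <- s) z *~ c z) => //.
    transitivity (\sum_(z <- [seq z <- [:: x; y] | z \in s]) z *~ c z).
      rewrite big_filter big_mkcond !big_cons big_nil /= addr0 /c'.
      by congr (_ + _); case: ifP; rewrite ?mulr0z.
    apply/perm_big/uniq_perm => //.
      by rewrite filter_uniq//= inE andbT eq_sym.
    move=> z; rewrite mem_filter !inE; apply/andb_idr.
    by move=> /sxy[] /= ->; rewrite eqxx ?orbT.
  have cy : c' y = 0.
    apply/eqP; apply: contraT => cy; case: ndep; exists (c' y), (- c' x).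
    by split=> //; apply/eqP; rewrite mulrNz -addr_eq0 addrC xyE.
  have cx : c' x = 0.
    apply/eqP; apply: contraT => cx; move: xyE; rewrite cy mulr0z addr0.
    by move=> /(torsion_free_mulz tfA cx) x00; rewrite x00 eqxx in x0.
  move=> z zs; have [/= zx|/= zy] := sxy z zs.
    by move: cx; rewrite /c' -zx zs.
  by move: cy; rewrite /c' -zy zs.
have : [set x; y] y by right.
by rewrite xyS SE => /= yx'; rewrite yx' eqxx in yx.
Qed.

Lemma fsum_seq (I : choiceType) (V : zmodType) (s : seq I) (f : I -> V) :
  uniq s -> (forall i, i \notin s -> f i = 0) ->
  \sum_(i \in [set: I]) f i = \sum_(i <- s) f i.
Proof.
move=> us f0; rewrite (fsbigE s)//; last by move=> i _; apply: f0.
by apply: eq_bigl => i; apply: mem_set.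
Qed.

Lemma torsion_free_inj (G H : zmodType) (f : {additive G -> H}) :
  injective f -> torsion_free H -> torsion_free G.
Proof.
move=> finj tfH x n n0 xn; apply: finj; rewrite raddf0.
by apply: (tfH _ n n0); rewrite -raddfMn xn raddf0.
Qed.

Lemma torsion_free_subgroup (G : zmodType) (H : zmodClosed G) :
  torsion_free G -> torsion_free (subgroup H).
Proof.
exact: (@torsion_free_inj _ _ (\val : {additive subgroup H -> G}) val_inj).
Qed.

Lemma bounded_p_torsion_subgroup (G : zmodType) (H : zmodClosed G) :
  bounded_p_torsion G -> bounded_p_torsion (subgroup H).
Proof.
move=> bG p pp; have [n nP] := bG p pp; exists n => x [k xk].
apply: val_inj; rewrite raddfMn raddf0; apply: nP; exists k.
by rewrite -raddfMn xk raddf0.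
Qed.

(** The idempotent [inc \o ret] has a completely decomposable image,
    isomorphic to [K]. The summands are indexed by the elements of an
    independent set that decomposes the image, the one of [x] being the
    subgroup of [K] that corresponds to the pure subgroup generated by [x]. *)
Lemma completely_decomposable_retract (A K : zmodType) (I : eqType)
    (rho : I -> {additive A -> A}) (b : I -> A)
    (inc : {additive K -> A}) (ret : {additive A -> K}) :
  torsion_free A -> rank1_decomposition rho b -> (forall k, ret (inc k) = k) ->
  completely_decomposable K.
Proof.
move=> tfA dec incK.
pose pi : {additive A -> A} := inc \o ret.
have [X [indX spanX fixX]] : cd_idempotent pi.
  by apply: (cd_of_idempotent tfA dec) => a; rewrite /= incK.
have inc_inj : injective inc by apply: can_inj incK.
have tfK := torsion_free_inj inc_inj tfA.
have Xret x : X x -> inc (ret x) = x by move=> /fixX.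
have Xne0 x : X x -> x != 0 := independent_neq0 indX.
have /choice[H HE] : forall x, exists H : zmodClosed K,
    forall k, (k \in H) = `[< dep x (inc k) >].
  move=> x; apply: (ex_subgroup (S := [set k | dep x (inc k)])) => [|k l] /=.
    by rewrite raddf0; apply: dep0r.
  by rewrite raddfB; apply: depB.
pose J : choiceType := X.
exists J, (fun x : J => subgroup (H (val x)) : zmodType).
exists (fun x : J => \val : {additive subgroup (H (val x)) -> K}).
have JX (x : J) : X (val x) by have := valP x; rewrite inE.
split=> [x|k].
- have xH : ret (val x) \in H (val x).
    by rewrite HE Xret//; apply/asboolP; apply: dep_refl.
  apply: (@rank1_dep _ (Subgroup xH)).
  + exact: torsion_free_subgroup.
  + apply: contra (Xne0 _ (JX x)) => /eqP/(congr1 val) /= x0.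
    by rewrite -(Xret _ (JX x)) x0 raddf0.
  + move=> [y yH]; have := yH; rewrite HE => /asboolP[m [l [m0 yx]]].
    exists m, l; split=> //; apply: val_inj; apply: inc_inj.
    by rewrite !raddfMz /= yx (Xret _ (JX x)).
- have ex_c v : hull X v -> exists (s : seq J) (c : J -> K), [/\ uniq s,
      forall x, c x \in H (val x), forall x, x \notin s -> c x = 0 &
      v = \sum_(x <- s) inc (c x)].
    elim=> [|x w v' Xx xw _ [s [c [us cH c0 ->]]]].
      exists [::], (fun=> 0); split=> //; last by rewrite big_nil.
      by move=> x; apply: rpred0.
    have xX : x \in X by rewrite inE.
    pose xJ : J := exist _ x xX.
    have wE : inc (ret w) = w by apply: (dep_hom_id tfA (f := pi) xw (fixX _ Xx)).
    pose c' y := c y + (if y == xJ then ret w else 0).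
    have sub0 : forall y, y \notin s -> c y = 0 by [].
    exists (undup (xJ :: s)), c'; split.
    + exact: undup_uniq.
    + move=> y; rewrite rpredD//; case: eqP => [->|_]; last exact: rpred0.
      by rewrite HE wE; apply/asboolP.
    + move=> y; rewrite mem_undup inE negb_or => /andP[/negPf yx /c0 cy].
      by rewrite /c' cy yx addr0.
    + have -> : \sum_(y <- s) inc (c y) = \sum_(y <- undup (xJ :: s)) inc (c y).
        rewrite -[LHS](@fsum_seq J A s (inc \o c))//; last first.
          by move=> y /c0 /= ->; rewrite raddf0.
        rewrite (@fsum_seq J A (undup (xJ :: s)))// ?undup_uniq// => y.
        rewrite mem_undup inE negb_or => /andP[_ /c0 /= ->].
        by rewrite raddf0.
      rewrite [RHS](eq_bigr (fun y => inc (c y) + inc (if y == xJ then ret w else 0))).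
        rewrite big_split /= addrC; congr (_ + _).
        have xJt : xJ \in undup (xJ :: s) by rewrite mem_undup mem_head.
        rewrite (bigD1_seq xJ xJt (undup_uniq _)).
        rewrite eqxx wE big1 /= ?addr0// => y /negPf ->.
        by rewrite raddf0.
      by move=> y _; rewrite raddfD.
  have [s [c [us cH c0 kE]]] := ex_c _ (spanX (inc k)).
  pose a (x : J) : subgroup (H (val x)) := Subgroup (cH x).
  have vala x : \val (a x) = c x by [].
  have {}kE : k = \sum_(x <- s) c x.
    by apply: inc_inj; rewrite raddf_sum -kE /= incK.
  exists a; split.
    split.
      apply: (@sub_finite_set _ _ [set` s]) => // x /= ax.
      apply: contraT => /c0 cx; case/eqP: ax; exact: val_inj.
    rewrite (@fsum_seq J K s)//.
  move=> a' [/finite_seqP[s' s'E] kE'].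
  have s'0 x : x \notin s' -> a' x = 0.
    move=> xs'; apply/eqP; apply: contraT => a'x.
    have : [set` s'] x by rewrite -s'E.
    by rewrite /= (negPf xs').
  apply: functional_extensionality_dep => x; apply: val_inj; apply: subr0_eq.
  pose t := undup (s ++ s').
  have tP y : y \notin t -> y \notin s /\ y \notin s'.
    by rewrite mem_undup mem_cat negb_or => /andP.
  have sum0 : \sum_(y <- t) (c y - \val (a' y)) = 0.
    rewrite big_split /= sumrN; apply/eqP; rewrite subr_eq0; apply/eqP.
    have tu : uniq t := undup_uniq _.
    transitivity k.
      rewrite kE -(@fsum_seq J K t c tu); last by move=> y /tP[/c0].
      exact: fsum_seq.
    rewrite kE'; apply: fsum_seq => // y /tP[_ /s'0 ->].
    exact: raddf0.
  have [xt|/tP[xs xs']] := boolP (x \in t); last by rewrite /= c0// s'0// subr0.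
  pose d (z : A) : A := if pselect (z \in X) is left zX then
    inc (c (exist _ z zX) - \val (a' (exist _ z zX))) else 0.
  have dE (y : J) : d (val y) = inc (c y - \val (a' y)).
    rewrite /d; case: pselect => [yX|]; last by case; apply: valP.
    by have -> : exist _ (val y) yX = y by apply: val_inj.
  apply: inc_inj; rewrite raddf0 /= -dE.
  apply: (@independent_dep _ X (map val t) d) => //.
  - by rewrite map_inj_uniq ?undup_uniq//; apply: val_inj.
  - by move=> _ /mapP[y _ ->]; apply: JX.
  - move=> _ /mapP[y _ ->]; rewrite dE.
    have : c y - \val (a' y) \in H (val y) by rewrite rpredB//; apply: valP.
    by rewrite HE => /asboolP.
  - rewrite big_map (eq_bigr (fun y => inc (c y - \val (a' y)))) => [|y _]; last exact: dE.
    by rewrite -raddf_sum sum0 raddf0.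
  - exact: map_f.
Qed.

(** * Lifting from completely decomposable groups *)

Section DirectSum.
Variables (I : choiceType) (A : I -> zmodType) (G : zmodType).
Variable inj : forall i, {additive A i -> G}.
Hypothesis sumG : is_direct_sum inj.

(** An element of a summand and 0 cannot have the same image, since 0 has
    only the trivial family of components. *)
Lemma direct_sum_inj i : injective (inj i).
Proof.
suff inj0 a : inj i a = 0 -> a = 0.
  by move=> x y e; apply/subr0_eq/inj0; rewrite raddfB e subrr.
move=> a0; have [z [_ uz]] := sumG 0.
pose d : forall j, A j := dfwith (fun j => 0 : A j) i a.
have d0 j : j \notin [:: i] -> d j = 0.
  by rewrite inE eq_sym => ij; rewrite /d dfwithout.
have sup : [set j | d j != 0] `<=` [set` [:: i]].
  by move=> j /= dj; apply: contraT => /d0 e; rewrite e eqxx in dj.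
have zd : z = d.
  apply: uz; split; first exact: sub_finite_set sup (finite_seq _).
  rewrite (@fsum_seq I G [:: i])//; last by move=> j /d0 ->; rewrite raddf0.
  by rewrite big_seq1 /d dfwithin a0.
have z0 : z = fun j => 0.
  apply: uz; split; last by rewrite (@fsum_seq I G [::]) ?big_nil// => j _; rewrite raddf0.
  by apply: (@sub_finite_set _ _ [set` ([::] : seq I)]) => // j /=; rewrite eqxx.
have := congr1 (fun f => f i) zd; by rewrite z0 /d dfwithin.
Qed.

Lemma direct_sum_lift (B C : zmodType) (g : {additive B -> C})
    (phi : {additive G -> C}) (h : forall i, {additive A i -> B}) :
  (forall i a, g (h i a) = phi (inj i a)) ->
  exists psi : {additive G -> B}, forall x, g (psi x) = phi x.
Proof.
move=> gh; have /choice[c cP] : forall x, exists a : forall i, A i,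
    finite_set [set i | a i != 0] /\ x = \sum_(i \in [set: I]) inj i (a i).
  by move=> x; have [a [aP _]] := sumG x; exists a.
have cuniq x a : finite_set [set i | a i != 0] ->
    x = \sum_(i \in [set: I]) inj i (a i) -> c x = a.
  move=> afin xE; have [z [_ uz]] := sumG x.
  by rewrite -(uz _ (cP x)) -(uz a).
have csupp x : exists s : seq I, uniq s /\ forall i, i \notin s -> c x i = 0.
  have [/finite_seqP[s sE] _] := cP x; exists (undup s); split.
    exact: undup_uniq.
  move=> i; rewrite mem_undup => nis; apply/eqP; apply: contraT => ci.
  have : [set` s] i by rewrite -sE.
  by rewrite /= (negPf nis).
pose f x := \sum_(i \in [set: I]) h i (c x i).
have fB : zmod_morphism f.
  move=> x y; have [s [us sx]] := csupp x; have [t [ut ty]] := csupp y.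
  pose w := undup (s ++ t).
  have uw : uniq w := undup_uniq _.
  have wP i : i \notin w -> c x i = 0 /\ c y i = 0.
    by rewrite mem_undup mem_cat negb_or => /andP[/sx -> /ty ->].
  have sum_w (B' : zmodType) (k : forall i, {additive A i -> B'}) (a : forall i, A i) :
      (forall i, i \notin w -> a i = 0) ->
      \sum_(i \in [set: I]) k i (a i) = \sum_(i <- w) k i (a i).
    by move=> a0; apply: fsum_seq => // i /a0 ->; rewrite raddf0.
  have cB : c (x - y) = fun i => c x i - c y i.
    apply: cuniq.
      apply: (@sub_finite_set _ _ [set` w]) => // i /= ci.
      by apply: contraT => /wP[cx cy]; rewrite cx cy subrr eqxx in ci.
    rewrite sum_w => [|i /wP[-> ->]]; last by rewrite subrr.
    rewrite (eq_bigr (fun i => inj i (c x i) - inj i (c y i))); last first.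
      by move=> i _; rewrite raddfB.
    rewrite big_split /= sumrN; congr (_ - _).
      by rewrite [LHS](cP x).2 sum_w// => i /wP[].
    by rewrite [LHS](cP y).2 sum_w// => i /wP[].
  rewrite /f cB (sum_w _ _ (c x)) => [|i /wP[]//].
  rewrite (sum_w _ _ (c y)) => [|i /wP[]//].
  rewrite (sum_w _ _ (fun i => c x i - c y i)) => [|i /wP[-> ->]]; last first.
    by rewrite subrr.
  by rewrite -sumrB; apply: eq_bigr => i _; rewrite raddfB.
have [psi psiE] := ex_additive fB; exists psi => x.
rewrite psiE /f; have [s [us sx]] := csupp x.
rewrite (@fsum_seq I B s)//; last by move=> i /sx ->; rewrite raddf0.
rewrite [in RHS](cP x).2 (@fsum_seq I G s)//; last by move=> i /sx ->; rewrite raddf0.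
by rewrite !raddf_sum; apply: eq_bigr => i _; apply: gh.
Qed.

End DirectSum.

(** Choosing the image of a generator without loss of height makes
    [height_extension] applicable. *)
Lemma rank1_lift (R B C : zmodType) (g : {additive B -> C})
    (phi : {additive R -> C}) :
  socle_lifting g -> height_lifting g -> torsion_free R ->
  has_torsion_free_rank R 1 ->
  exists psi : {additive R -> B}, forall x, g (psi x) = phi x.
Proof.
move=> sg hg tfR /(rank1_generator tfR)[r r0 rdep].
have [b [gb bh]] := hg (phi r).
have [|psi [gpsi _]] := height_extension sg tfR r0 rdep gb; last by exists psi.
by move=> p pp a ra; apply: bh => //; apply: ppow_hom.
Qed.

Lemma balanced_projective_of_splitting (G A : zmodType) : bounded_p_torsion G ->
  torsion_free A -> completely_decomposable A ->
  isomorphic G (subgroup (torsion G) * A)%type -> balanced_projective G.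
Proof.
move=> bG tfA [I [R [inj [rankR sumA]]]] [e [d eK dK]] A' B C f g bal phi.
have sg := balanced_socle_lifting bal; have hg := balanced_height_lifting bal.
have dB : zmod_morphism d.
  by move=> x y; apply: (can_inj eK); rewrite raddfB !dK.
have [d' d'E] := ex_additive dB.
have lB : zmod_morphism (fun t : subgroup (torsion G) => (t, 0 : A)).
  by move=> x y; congr (_, _); rewrite subr0.
have rB : zmod_morphism (fun a : A => (0 : subgroup (torsion G), a)).
  by move=> x y; congr (_, _); rewrite subr0.
have [l lE] := ex_additive lB; have [r rE] := ex_additive rB.
have [||psi1 psi1P] := torsion_lift (phi \o (d' \o l)) sg.
- move=> [x xT]; have := xT; rewrite inE => -[n n0 xn].
  by exists n => //; apply: val_inj; rewrite raddfMn.
- exact: bounded_p_torsion_subgroup.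
have tfR i : torsion_free (R i) := torsion_free_inj (direct_sum_inj sumA (i := i)) tfA.
pose h i := cid (rank1_lift (phi \o (d' \o (r \o inj i))) sg hg (tfR i) (rankR i)).
have [psi2 psi2P] := direct_sum_lift sumA (phi := phi \o (d' \o r))
  (h := fun i => sval (h i)) (fun i => svalP (h i)).
exists ((psi1 \o (fst \o e)) \+ (psi2 \o (snd \o e))) => x.
rewrite raddfD /= psi1P psi2P /= -!raddfD lE rE !d'E; congr (phi _).
have -> : ((e x).1, 0) + (0, (e x).2) = e x :> (subgroup (torsion G) * A)%type.
  by rewrite [RHS]surjective_pairing; congr (_, _); rewrite ?addr0 ?add0r.
by rewrite eK.
Qed.

(** * Balanced-projective groups are Warfield groups *)

Lemma ex_freeg_lift (X : choiceType) (V : zmodType) (f : X -> V) :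
  exists F : {additive {freeg X} -> V}, forall x, F << x >> = f x.
Proof.
pose f' : X -> zmodule V := f.
have fB : zmod_morphism (fglift f' : {freeg X} -> V).
  by move=> x y; exact: (lift_is_additive f' x y).
have [F FE] := ex_additive fB.
by exists F => x; rewrite FE liftU scale1r.
Qed.

Lemma freeg_generated (X : choiceType) (H : zmodClosed {freeg X}) :
  (forall x, << x >> \in H) -> forall w, w \in H.
Proof.
move=> HX w; rewrite -(freeg_sumE w); apply: rpred_sum => x _.
have -> : << coeff x w *g x >> = (<< x >> : {freeg X}) *~ coeff x w.
  by rewrite freegU_mulz intz.
exact: rpredMz.
Qed.

Lemma balanced_projective_splits (G B : zmodType) (g : {additive B -> G}) :
  balanced_projective G -> socle_lifting g -> height_lifting g ->
  exists s : {additive G -> B}, forall x, g (s x) = x.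
Proof.
move=> projG sg hg.
have [||H HE] := @ex_subgroup B [set y | g y = 0].
- exact: raddf0.
- by move=> x y /= gx gy; rewrite raddfB gx gy subrr.
pose f : {additive subgroup H -> B} := \val.
have bal : balanced f g.
  apply: balancedP => //; split; first by move=> x y _ _; apply: val_inj.
    apply/seteqP; split=> [_ [[y yH] _ <-]|y [_ gy]].
      by split=> //=; move: yH; rewrite HE => /asboolP.
    have yH : y \in H by rewrite HE; apply/asboolP.
    by exists (Subgroup yH).
  by apply/seteqP; split=> // c _; have [b [gb _]] := hg c; exists b.
by have [s sP] := projG _ _ _ _ _ bal idfun; exists s.
Qed.

Lemma retract_direct_summand (G S : zmodType) (s : {additive G -> S})
    (g : {additive S -> G}) : (forall x, g (s x) = x) ->
  exists H : zmodClosed S, direct_summand H /\ isomorphic G (subgroup H).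
Proof.
move=> gs.
have [||H HE] := @ex_subgroup S [set y | s (g y) = y].
- by rewrite /= !raddf0.
- by move=> x y /= sx sy; rewrite !raddfB sx sy.
have [||K KE] := @ex_subgroup S [set y | g y = 0].
- exact: raddf0.
- by move=> x y /= gx gy; rewrite raddfB gx gy subrr.
exists H; split.
  exists K; split=> [x|x].
    by rewrite HE KE => /asboolP /= sgx /asboolP /= gx; rewrite -sgx gx raddf0.
  exists (s (g x)), (x - s (g x)); split; last by rewrite subrKC.
    by rewrite HE; apply/asboolP; rewrite /= gs.
  by rewrite KE; apply/asboolP; rewrite /= raddfB gs subrr.
have sH x : s x \in H by rewrite HE; apply/asboolP; rewrite /= gs.
have fB : zmod_morphism (fun x => Subgroup (sH x)).
  by move=> x y; apply: val_inj; rewrite /= raddfB.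
have [f fE] := ex_additive fB; exists f; exists (g \o \val) => [x|[y yH]] /=.
  by rewrite fE /= gs.
by rewrite fE; apply: val_inj; move: yH => /=; rewrite HE => /asboolP.
Qed.

(** [G] is the image of the group presented by symbols [[x]], for [x] in
    [G], and the relations [p [x] = [p x]]. The symbol of [x] inherits the
    heights of [x] by induction on ordinals, and its order when [x] has
    order [p], because [2 [0] = [0]] forces the symbol of 0 to vanish. So
    this image is a balanced one, and [G] splits off. *)
Lemma warfield_of_balanced_projective (G : zmodType) :
  balanced_projective G -> warfield G.
Proof.
move=> projG.
pose R : set (nat * G * G) := [set t | prime t.1.1 /\ t.2 = t.1.2 *+ t.1.1].
pose N := generated (relators R set0).
have [||S [q [qsurj kerq]]] := @ex_quotient {freeg G} N.
- by move=> H _; apply: rpred0.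
- by move=> x y Nx Ny H HR; apply: rpredB; [apply: Nx|apply: Ny].
have [ev evE] := ex_freeg_lift (fun x : G => x).
have evN w : N w -> ev w = 0.
  have [||H HE] := @ex_subgroup {freeg G} [set w | ev w = 0].
  - exact: raddf0.
  - by move=> x y /= gx gy; rewrite raddfB gx gy subrr.
  move=> /(_ H); rewrite HE => Hw; apply/asboolP/Hw => y [[p [x [z [[/= _ ->] ->]]]]|].
    by rewrite HE; apply/asboolP; rewrite /= raddfB raddfMn !evE subrr.
  by move=> [p [x []]].
have [g gE] := factor_additive qsurj (fun w => fun qw => evN w ((kerq w).1 qw)).
pose sym x := q << x >>.
have gsym x : g (sym x) = x by rewrite gE evE.
have symM p x : prime p -> sym (x *+ p) = sym x *+ p.
  move=> pp; apply/esym/subr0_eq; rewrite -raddfMn -raddfB; apply/kerq => H; apply.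
  by left; exists p, x, (x *+ p).
have sym0 : sym 0 = 0.
  have := symM 2 0 isT; rewrite mul0rn mulr2n => e.
  by apply: (addrI (sym 0)); rewrite addr0.
have sym_ppow p a x : prime p -> ppow G p a x -> ppow S p a (sym x).
  move=> pp; elim: a x => [|a IH|I F IH] x //=; last by move=> Hx i; apply: IH.
  by move=> [y Hy <-]; exists (sym y); [apply: IH|rewrite symM].
have [||s sK] := balanced_projective_splits (g := g) projG.
- move=> p a c pp ca cp; exists (sym c); split=> //; first exact: sym_ppow.
  by rewrite -symM// cp sym0.
- by move=> c; exists (sym c); split=> // p a pp; apply: sym_ppow.
have [H [sumH isoH]] := retract_direct_summand sK.
exists S, H; split=> //; exists G, R, set0, q; split=> //.
  by move=> p x y [].
by apply/seteqP; split=> w /kerq.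
Qed.

(** * Balanced-projective groups with bounded torsion split *)

(** If the [p]-torsion is killed by [p^e], then [p^e G] has no [p]-torsion,
    so an element divisible by all powers of [p] has only one quotient by
    [p] in [p^e G], and this quotient is again divisible by all powers of
    [p]. *)
Lemma bounded_ppow_infty (G : zmodType) p (x : G) : bounded_p_torsion G ->
  prime p -> (forall n, ppow G p (onat n) x) -> forall a, ppow G p a x.
Proof.
move=> bG pp xoo a; have [e eP] := bG p pp.
elim: a x xoo => [|a IH|I F IH] x xoo //=; last by move=> i; apply: IH.
have /choice[z zP] : forall k, exists z, x = z *+ p ^ k.
  by move=> k; apply/ppow_onatP.
pose y := z e.+1 *+ p ^ e.
have yx : y *+ p = x by rewrite -mulrnA -expnSr -zP.
exists y => //; apply: IH => n; apply: (@ppow_onat_le _ _ _ (n + e)); first exact: leq_addr.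
apply/ppow_onatP; exists (z (n + e).+1); apply/subr0_eq.
rewrite expnD mulrnA -mulrnBl; apply: eP; exists e.+1.
by rewrite mulrnBl -mulrnA -expnD -zP addnS -zP subrr.
Qed.

Section HeightGroup.
Variables (G : zmodType) (x : G).

Definition divides_height (d : nat) : Prop := (0 < d)%N /\
  forall p i, prime p -> (p ^ i %| d)%N -> ppow G p (onat i) x.

(** The rational numbers by which [x] could be multiplied, as far as its
    heights at the individual primes are concerned: the rational group in
    which the heights of 1 are those of [x]. *)
Definition height_group : set rat :=
  [set q | exists (d : nat) (k : int), divides_height d /\ q *+ d = k%:~R].

Lemma divides_height_lcm d d' : divides_height d -> divides_height d' ->
  divides_height (lcmn d d').
Proof.
move=> [d0 dP] [d'0 d'P]; have l0 : (0 < lcmn d d')%N by rewrite lcmn_gt0 d0.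
split=> // p i pp; rewrite pfactor_dvdn// logn_lcm// leq_max -!pfactor_dvdn//.
by move=> /orP[]; [apply: dP|apply: d'P].
Qed.

Lemma height_group0 : height_group 0.
Proof.
exists 1%N, 0; split; last by rewrite mulr1n mulr0z.
by split=> // p [|i] pp //; rewrite dvdn1 expnS muln_eq1 => /andP[/eqP p1]; rewrite p1 in pp.
Qed.

Lemma height_groupB q q' : height_group q -> height_group q' -> height_group (q - q').
Proof.
move=> [d [k [dx qd]]] [d' [k' [d'x q'd']]].
have [m mE] := dvdnP (dvdn_lcml d d'); have [m' mE'] := dvdnP (dvdn_lcmr d d').
exists (lcmn d d'), (k *+ m - k' *+ m'); split; first exact: divides_height_lcm.
rewrite mulrnBl {1}mE mE' mulnC mulrnA qd mulnC mulrnA q'd'.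
by rewrite rmorphB /= !rmorphMn.
Qed.

Lemma divides_height_ppow p n : prime p -> ppow G p (onat n) x ->
  divides_height (p ^ n).
Proof.
move=> pp xn; split=> [|q i pq]; first by rewrite expn_gt0 prime_gt0.
have [->|i0] := posnP i; first by [].
move=> qi; have /eqP qp : q == p.
  rewrite -(dvdn_prime2 pq pp); have : (q %| p ^ n)%N.
    by apply: dvdn_trans qi; rewrite dvdn_exp.
  by rewrite (Euclid_dvdX _ _ pq) => /andP[].
move: qi; rewrite qp pfactor_dvdn ?expn_gt0 ?prime_gt0// pfactorK// => le_in.
exact: ppow_onat_le xn.
Qed.

Lemma height_group1 : height_group 1.
Proof.
exists 1%N, 1; split=> //; split=> // p [|i] pp //.
by rewrite dvdn1 expnS muln_eq1 => /andP[/eqP p1]; rewrite p1 in pp.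
Qed.

(** By construction [1 / p^n] belongs to the group iff [p^n] divides [x]. *)
Lemma height_group_ppow (H : zmodClosed rat) (HE : forall q, (q \in H) = `[< height_group q >])
    (one : subgroup H) p n : \val one = 1 -> prime p ->
  ppow (subgroup H) p (onat n) one <-> ppow G p (onat n) x.
Proof.
move=> one1 pp; have p0 : (p ^ n)%:R != 0 :> rat.
  by rewrite Num.Theory.pnatr_eq0 -lt0n expn_gt0 prime_gt0.
split=> [/ppow_onatP[[q qH] qE]|xn].
  move: (qH); rewrite HE => /asboolP[d [k [[d0 dx] qd]]]; apply: (dx) => //.
  have /= q1 : q *+ p ^ n = 1 by rewrite -one1 qE raddfMn.
  have dE : d%:Z = k * (p ^ n)%N.
    apply: (@intr_inj rat); rewrite rmorphM /= -qd -!pmulrn.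
    by rewrite mulr_natr -mulrnA mulnC mulrnA q1.
  by have : ((p ^ n)%N %| d%:Z)%Z by rewrite dE dvdz_mull.
apply/ppow_onatP.
have qH : ((p ^ n)%:R^-1 : rat) \in H.
  rewrite HE; apply/asboolP; exists (p ^ n)%N, 1; split.
    exact: divides_height_ppow.
  by rewrite -[LHS]mulr_natr mulVf.
exists (Subgroup qH); apply: val_inj.
by rewrite raddfMn /= one1 -[RHS]mulr_natr mulVf.
Qed.

End HeightGroup.

Lemma torsion_free_bounded (G : zmodType) : torsion_free G -> bounded_p_torsion G.
Proof.
move=> tfG p pp; exists 0%N => x [k xk].
by rewrite (tfG x (p ^ k)%N _ xk) ?mul0rn// expn_gt0 prime_gt0.
Qed.

Lemma torsion_free_rat : torsion_free rat.
Proof.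
move=> q n n0 /eqP; rewrite -mulr_natr mulf_eq0 Num.Theory.pnatr_eq0.
by rewrite (gtn_eqF n0) orbF => /eqP.
Qed.

(** Heights of 1 in the rational group do not exceed heights of [x], also at
    infinite ordinals, as [G] has bounded [p]-torsion; so
    [height_extension], applied to the zero map of [G], extends the map
    taking 1 to [x]. Writing it as a function on all rational numbers gives
    these homomorphisms a common domain for different [x]. *)
Lemma height_group_hom (G : zmodType) (x : G) : bounded_p_torsion G ->
  exists f : rat -> G, f 1 = x /\
    forall q q', height_group x q -> height_group x q' -> f (q - q') = f q - f q'.
Proof.
move=> bG; have [H HE] := ex_subgroup (height_group0 x) (@height_groupB G x).
have tfH : torsion_free (subgroup H) := torsion_free_subgroup torsion_free_rat.
have H1 : 1 \in H by rewrite HE; apply/asboolP/height_group1.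
pose one : subgroup H := Subgroup H1.
have one0 : one != 0 by apply/eqP => /(congr1 val) /eqP; rewrite oner_eq0.
have rank q : dep one q.
  exists (denq (val q)), (numq (val q)); split; first exact: denq_neq0.
  apply: val_inj; rewrite !raddfMz /= -[LHS]mulrzr.
  by rewrite -numqE.
have [|||psi [_ psi1]] := @height_extension (subgroup H) G 'I_1 \0 \0 _ tfH one one0 rank x.
- move=> p a c _ _ _; exists 0; split; [exact: ppow0|by rewrite mul0rn|].
  by rewrite [c]ord1.
- by [].
- move=> p pp; apply: ppow_le_finite => [n|]; last exact: bounded_ppow_infty.
  by move/(height_group_ppow HE (one := one)); apply.
pose f q := psi (insubd 0 q).
exists f; split; first by rewrite /f -[1]/(val one) valKd.
move=> q q' qx q'x; rewrite /f -raddfB; congr (psi _); apply: val_inj.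
have inH r : height_group x r -> r \in H by move=> ?; rewrite HE; apply/asboolP.
rewrite raddfB /= !insubdK//; apply: inH => //; exact: height_groupB.
Qed.

(** [G] is a balanced image of a group [B], the direct sum of the torsion
    subgroup of [G] and the rational groups of all elements of [G], hence a
    retract of [B]. The torsion subgroup is a direct summand of [B], and
    this property is inherited by retracts. *)
Lemma splitting_of_balanced_projective (G : zmodType) : bounded_p_torsion G ->
  balanced_projective G -> splitting_mixed G.
Proof.
move=> bG projG.
have /choice[f /all_and2[f1 fB]] := fun x : G => height_group_hom x bG.
pose fin (u : G -> rat) := exists s : seq G, uniq s /\ forall x, x \notin s -> u x = 0.
have fin2 u v : fin u -> fin v -> exists s : seq G, uniq s /\
    forall x, x \notin s -> u x = 0 /\ v x = 0.
  move=> [s [us su]] [t [ut tv]]; exists (undup (s ++ t)); split.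
    exact: undup_uniq.
  by move=> x; rewrite mem_undup mem_cat negb_or => /andP[/su -> /tv ->].
pose S : set (G -> rat) := [set u | fin u /\ forall x, height_group x (u x)].
have [||H HE] := @ex_subgroup (G -> rat) S.
- split; first by exists [::].
  by move=> x; apply: height_group0.
- move=> u v [fu hu] [fv hv]; have [s [us suv]] := fin2 u v fu fv; split.
    exists s; split=> // x /suv[ux vx].
    by rewrite -[LHS]/(u x - v x) ux vx subrr.
  by move=> x; apply: (height_groupB (hu x) (hv x)).
have f0 x : f x 0 = 0.
  by rewrite -{1}(subrr (0 : rat)) fB ?subrr//; apply: height_group0.
pose sigma (u : subgroup H) : G := \sum_(x \in [set: G]) f x (val u x).
have HS (u : subgroup H) : S (val u).
  by have := valP u; rewrite /= HE => /asboolP.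
have sigmaB : zmod_morphism sigma.
  move=> u v; have [s [us suv]] := fin2 _ _ (HS u).1 (HS v).1.
  have sumE (w : subgroup H) : (forall x, x \notin s -> val w x = 0) ->
      sigma w = \sum_(x <- s) f x (val w x).
    by move=> w0; apply: fsum_seq => // x /w0 ->.
  have uvE x : val (u - v) x = val u x - val v x by rewrite raddfB.
  rewrite !sumE => [|x /suv[]//|x /suv[]//|x /suv[ux vx]]; last first.
    by rewrite uvE ux vx subrr.
  rewrite -sumrB; apply: eq_bigr => x _.
  by rewrite uvE fB//; [apply: (HS u).2|apply: (HS v).2].
have [sg sgE] := ex_additive sigmaB.
pose T := subgroup (torsion G).
pose B := (subgroup H * T)%type : zmodType.
pose g : {additive B -> G} := (sg \o fst) \+ (\val \o snd).
have deltaH c q : height_group c q -> (fun x => if x == c then q else 0) \in H.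
  move=> cq; rewrite HE; apply/asboolP; split.
    by exists [:: c]; split=> // x; rewrite inE => /negPf ->.
  by move=> x; case: eqP => [->|_] //; apply: height_group0.
have bT : bounded_p_torsion T := bounded_p_torsion_subgroup _ bG.
have [||s sK] := balanced_projective_splits (g := g) projG.
- move=> p a c pp ca cp.
  have cT : c \in torsion G by rewrite inE; exists p => //; apply: prime_gt0.
  have inB : zmod_morphism (fun t : T => (0, t) : B).
    by move=> t t'; congr (_, _); rewrite subr0.
  have [i iE] := ex_additive inB.
  exists (i (Subgroup cT)); split.
  + apply/ppow_hom; move: a ca; apply: ppow_le_finite => [n|]; last first.
      exact: bounded_ppow_infty.
    move=> /ppow_onatP[y cE]; apply/ppow_onatP.
    have yT : y \in torsion G.
      rewrite inE; exists (p ^ n * p)%N; first by rewrite muln_gt0 expn_gt0 prime_gt0.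
      by rewrite mulrnA -cE.
    by exists (Subgroup yT); apply: val_inj; rewrite raddfMn.
  + rewrite -raddfMn iE; congr (_, _); apply: val_inj.
    by rewrite raddfMn /= cp.
  + by rewrite iE /g /= raddf0 add0r.
- move=> c.
  have [K KE] := ex_subgroup (height_group0 c) (@height_groupB G c).
  have tfK : torsion_free (subgroup K) := torsion_free_subgroup torsion_free_rat.
  have K1 : 1 \in K by rewrite KE; apply/asboolP/height_group1.
  pose one : subgroup K := Subgroup K1.
  have Kc (q : subgroup K) : height_group c (val q).
    by have := valP q; rewrite /= KE => /asboolP.
  have iB : zmod_morphism (fun q : subgroup K =>
      (Subgroup (deltaH c (val q) (Kc q)), 0) : B).
    move=> q q'; congr (_, _); last by rewrite subr0.
    apply: val_inj; apply: functional_extensionality_dep => x.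
    rewrite -[LHS]/(if x == c then val (q - q') else 0).
    rewrite -[RHS]/((if x == c then val q else 0) - (if x == c then val q' else 0)).
    by case: eqP => _; rewrite ?raddfB ?subr0.
  have [i iE] := ex_additive iB.
  exists (i one); split.
    rewrite iE -[LHS]/(sg (Subgroup (deltaH c _ (Kc one))) + \val (0 : T)).
    rewrite raddf0 addr0 sgE /sigma (@fsum_seq G G [:: c])//=.
      by rewrite big_seq1 eqxx f1.
    by move=> x; rewrite inE => /negPf ->.
  move=> p a pp ca; apply/ppow_hom; move: a ca.
  apply: ppow_le_finite => [n|].
    by move/(height_group_ppow KE (one := one)); apply.
  apply: bounded_ppow_infty => //; exact: torsion_free_bounded.
(* The retraction of G onto its torsion subgroup: the torsion part in B. *)
pose theta x : G := val (s x).2.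
have thetaB x y : theta (x - y) = theta x - theta y.
  by rewrite /theta raddfB -[LHS]/(val ((s x).2 - (s y).2)) raddfB.
have thetaT x : theta x \in torsion G by apply: valP.
have thetaid x : x \in torsion G -> theta x = x.
  rewrite inE => -[n n0 xn]; rewrite -[RHS]sK /g /=.
  have -> : (s x).1 = 0.
    have : (s x).1 *+ n = 0 by rewrite -(raddfMn fst) -raddfMn xn raddf0.
    apply: torsion_free_subgroup n0.
    move=> u m m0 um; apply: functional_extensionality_dep => z.
    apply: (torsion_free_rat m0).
    have <- : (u *+ m) z = u z *+ m; last by rewrite um.
    by elim: (m) => [|k IH] //; rewrite !mulrS -IH.
  by rewrite raddf0 add0r.
have [||L LE] := @ex_subgroup G [set x | theta x = 0].
- by have := thetaB 0 0; rewrite !subrr.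
- by move=> x y /= tx ty; rewrite thetaB tx ty subrr.
exists L; split=> [x xT|x].
  by rewrite LE => /asboolP /= tx; rewrite -(thetaid x xT).
exists (theta x), (x - theta x); split=> //; last by rewrite subrKC.
rewrite LE; apply/asboolP.
by rewrite /= thetaB [theta (theta x)]thetaid// subrr.
Qed.

(** * Splitting Warfield groups *)

Lemma freeg_ext (X : choiceType) (V : zmodType) (f g : {additive {freeg X} -> V}) :
  (forall x, f << x >> = g << x >>) -> f =1 g.
Proof.
move=> fg w; have [||H HE] := @ex_subgroup {freeg X} [set w | f w = g w].
- by rewrite /= !raddf0.
- by move=> x y /= fx fy; rewrite !raddfB fx fy.
have : w \in H by apply: freeg_generated => x; rewrite HE; apply/asboolP/fg.
by rewrite HE => /asboolP.
Qed.

(** The relations [p x = y] connect the generators, and connected generators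
    are linearly dependent. The projection onto the span of a connected
    component respects the relations, so modulo torsion [S] is the direct
    sum of groups of rank at most one, indexed by the components, which are
    coded as sets of generators. *)
Lemma simply_presented_modulo_torsion (S : zmodType) : simply_presented S ->
  exists (Q : zmodType) (I : eqType) (rho : I -> {additive Q -> Q}) (b : I -> Q)
    (j : {additive S -> Q}),
  [/\ torsion_free Q, rank1_decomposition rho b, forall y, exists x, j x = y &
      forall x, j x = 0 -> exists2 n, (0 < n)%N & x *+ n = 0].
Proof.
move=> [X [R [R0 [pi [Rprime _ pisurj kerpi]]]]].
have kerP w : pi w = 0 <-> generated (relators R R0) w.
  by rewrite -kerpi.
pose N : set {freeg X} := [set w | exists2 n, (0 < n)%N & pi w *+ n = 0].
have [||Q [q [qsurj kerq]]] := @ex_quotient {freeg X} N.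
- by exists 1%N => //; rewrite raddf0 mul0rn.
- move=> x y [m m0 xm] [n n0 yn]; exists (m * n)%N; first by rewrite muln_gt0 m0.
  by rewrite raddfB mulrnBl mulrnA xm mul0rn mulnC mulrnA yn mul0rn subrr.
have tfQ : torsion_free Q.
  move=> x n n0; have [w <-] := qsurj x; rewrite -raddfMn => /kerq[m m0].
  rewrite raddfMn -mulrnA => pw; apply/kerq; exists (n * m)%N => //.
  by rewrite muln_gt0 n0.
have piq w : pi w = 0 -> q w = 0.
  by move=> pw; apply/kerq; exists 1%N => //; rewrite pw mul0rn.
have [j jE] := factor_additive pisurj piq.
have jker x : j x = 0 -> exists2 n, (0 < n)%N & x *+ n = 0.
  by have [w <-] := pisurj x; rewrite jE => /kerq.
have jsurj y : exists x, j x = y.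
  by have [w <-] := qsurj y; exists (pi w).
pose conn x y := forall E : X -> X -> Prop, (forall x, E x x) ->
  (forall x y, E x y -> E y x) -> (forall x y z, E x y -> E y z -> E x z) ->
  (forall p x y, R (p, x, y) -> E x y) -> E x y.
pose comp x : set X := [set y | conn x y].
have comp_R p x y : R (p, x, y) -> comp x = comp y.
  move=> Rxy; apply/seteqP; split=> z xz E Er Es Et ER.
    by apply: Et (xz E Er Es Et ER); apply: Es; apply: ER Rxy.
  by apply: Et (xz E Er Es Et ER); apply: ER Rxy.
have conn_dep x y : comp x = comp y -> dep (q << x >>) (q << y >>).
  move=> xy; have : conn x y.
    by have : comp y y by []; rewrite -xy.
  pose E x y := exists m k : int, [/\ m != 0, k != 0 & q << y >> *~ m = q << x >> *~ k].
  move=> /(_ E)[||||m [k [m0 _ e]]]; last by exists m, k.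
  - by move=> z; exists 1, 1.
  - by move=> z t [m [k [m0 k0 e]]]; exists k, m.
  - move=> z t u [m [k [m0 k0 e]]] [m' [k' [m'0 k'0 e']]].
    exists (m' * m), (k * k'); split; rewrite ?mulf_neq0//.
    by rewrite !mulrzA e' mulrzAC e.
  - move=> p z t Rzt; exists 1, p; split=> //.
      by case: p {Rzt} (Rprime _ _ _ Rzt).
    rewrite mulr1z -pmulrn -raddfMn; apply/esym/subr0_eq; rewrite -raddfB.
    apply/piq/kerP => H; apply; left; by exists p, z, t.
pose rhoF (i : set X) := sval (cid (ex_freeg_lift (fun x =>
  if `[< comp x = i >] then << x >> else 0 : {freeg X}))).
have rhoFE i x : rhoF i << x >> = if `[< comp x = i >] then << x >> else 0.
  by rewrite /rhoF; case: cid.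
have rhoFker i w : pi w = 0 -> pi (rhoF i w) = 0.
  move=> /kerP; have [||H HE] := @ex_subgroup {freeg X} [set w | pi (rhoF i w) = 0].
  - by rewrite /= !raddf0.
  - by move=> x y /= fx fy; rewrite !raddfB fx fy subrr.
  move=> /(_ H); rewrite HE => Hw; apply/asboolP/Hw => {w Hw} w relw.
  have pw : pi w = 0 by apply/kerP => H'; apply.
  rewrite HE; apply/asboolP => /=; case: relw pw => [[p [x [y [Rxy ->]]]]|[p [x [_ ->]]]].
    rewrite !raddfB !raddfMn !rhoFE (comp_R _ _ _ Rxy).
    by case: ifP => // _ _; rewrite !raddf0 mul0rn addr0.
  by rewrite !raddfMn rhoFE; case: ifP; rewrite // raddf0 mul0rn.
have rhoQker i w : q w = 0 -> q (rhoF i w) = 0.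
  move=> /kerq[n n0 pw]; apply/kerq; exists n => //.
  by rewrite -!raddfMn; apply: rhoFker; rewrite raddfMn.
pose rho i := sval (cid (factor_additive (f := q \o rhoF i) qsurj (rhoQker i))).
have rhoE i w : rho i (q w) = q (rhoF i w).
  by rewrite /rho; case: cid => h /= ->.
have /choice[b bP] : forall i : set X, exists b : Q,
    forall x, comp x = i -> dep b (q << x >>).
  move=> i; have [[x0 x0i]|nx] := pselect (exists x, comp x = i); last first.
    by exists 0 => x xi; case: nx; exists x.
  by exists (q << x0 >>) => x xi; apply: conn_dep; rewrite xi.
exists Q, (set X), rho, b, j; split=> //; split.
- move=> i x; have [w <-] := qsurj x; rewrite !rhoE; congr (q _).
  apply: (freeg_ext (f := rhoF i \o rhoF i)) => y /=.
  by rewrite rhoFE; case: ifP => yi; rewrite ?raddf0// rhoFE yi.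
- move=> i i' x ii'; have [w <-] := qsurj x; rewrite !rhoE.
  rewrite -[RHS](raddf0 q); congr (q _).
  apply: (freeg_ext (f := rhoF i \o rhoF i') (g := \0)) => y /=.
  rewrite rhoFE; case: asboolP => yi'; rewrite ?raddf0// rhoFE asboolF//.
  by rewrite yi' => e; rewrite e eqxx in ii'.
- move=> x; have [w <-] := qsurj x.
  have [||H HE] := @ex_subgroup {freeg X} [set w | exists s : seq (set X),
      forall t, uniq t -> {subset s <= t} -> w = \sum_(i <- t) rhoF i w].
  + by exists [::] => t _ _; rewrite big1// => i _; rewrite raddf0.
  + move=> u v [s1 sP1] [s2 sP2]; exists (s1 ++ s2) => t ut st.
    rewrite (eq_bigr (fun i => rhoF i u - rhoF i v)) => [|i _]; last exact: raddfB.
    rewrite sumrB -sP1// -?sP2// => i is_; apply: st; rewrite mem_cat is_ ?orbT//.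
  have : w \in H.
    apply: freeg_generated => y; rewrite HE; apply/asboolP; exists [:: comp y] => t ut st.
    rewrite (bigD1_seq (comp y)) ?st ?mem_head//= rhoFE asboolT// big1 ?addr0//.
    by move=> i iy; rewrite rhoFE asboolF// => e; rewrite e eqxx in iy.
  rewrite HE => /asboolP[s sP]; exists (undup s); split; first exact: undup_uniq.
  rewrite {1}(sP (undup s)) ?undup_uniq//; last by move=> i; rewrite mem_undup.
  by rewrite raddf_sum; apply: eq_bigr => i _; rewrite rhoE.
- move=> i x; have [w <-] := qsurj x; rewrite rhoE.
  have [||H HE] := @ex_subgroup {freeg X} [set w | dep (b i) (q (rhoF i w))].
  + by rewrite /= !raddf0; apply: dep0r.
  + by move=> u v /= du dv; rewrite !raddfB; apply: depB.
  have : w \in H.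
    apply: freeg_generated => y; rewrite HE; apply/asboolP => /=; rewrite rhoFE.
    by case: asboolP => [yi|_]; [apply: bP|rewrite raddf0; apply: dep0r].
  by rewrite HE => /asboolP.
Qed.

Lemma direct_summand_projections (G : zmodType) (H : zmodClosed G) :
  direct_summand H -> exists (K : zmodClosed G)
    (prH : {additive G -> subgroup H}) (prK : {additive G -> subgroup K}),
  [/\ forall x, val (prH x : subgroup H) + val (prK x : subgroup K) = x,
      forall h : subgroup H, prH (val h) = h, forall h : subgroup H, prK (val h) = 0,
      forall k : subgroup K, prK (val k) = k & forall k : subgroup K, prH (val k) = 0].
Proof.
move=> [K [HK GHK]].
have /choice[f fP] : forall x, exists hk : subgroup H * subgroup K,
    val hk.1 + val hk.2 = x.
  move=> x; have [y [z [yH zK ->]]] := GHK x.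
  by exists (Subgroup yH, Subgroup zK).
have funiq (h h' : subgroup H) (k k' : subgroup K) :
    val h + val k = val h' + val k' -> h = h' /\ k = k'.
  move=> e; have d : val (h - h') = val (k' - k).
    rewrite !raddfB /=; apply/eqP; rewrite subr_eq addrAC; apply/eqP.
    by rewrite [X in _ = X - _]addrC -e addrK.
  have d0 : val (h - h') = 0.
    by apply: HK; [|rewrite d]; apply: valP.
  split; first by apply/subr0_eq/val_inj; rewrite d0 raddf0.
  by apply/esym/subr0_eq/val_inj; rewrite -d d0 raddf0.
have fE x h k : val h + val k = x -> f x = (h, k).
  move=> e; have /funiq[h1 k1] : val (f x).1 + val (f x).2 = val h + val k.
    by rewrite fP e.
  by rewrite [f x]surjective_pairing h1 k1.
have fB : zmod_morphism f.
  move=> x y; apply: (fE _ ((f x).1 - (f y).1) ((f x).2 - (f y).2)).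
  by rewrite !raddfB /= addrACA -opprD !fP.
have [F FE] := ex_additive fB.
exists K, (fst \o F), (snd \o F); split=> [x|h|h|k|k] /=; rewrite FE ?fP//.
- by rewrite (fE _ h 0)// raddf0 addr0.
- by rewrite (fE _ h 0)// raddf0 addr0.
- by rewrite (fE _ 0 k)// raddf0 add0r.
- by rewrite (fE _ 0 k)// raddf0 add0r.
Qed.

(** A complement of the torsion subgroup of [G] is a retract of a simply
    presented group [S] by a retraction that kills the torsion of [S], hence
    a retract of [S] modulo torsion. *)
Lemma decomposable_of_splitting_warfield (G : zmodType) :
  splitting_mixed G -> warfield G -> exists A : zmodType,
    [/\ torsion_free A, completely_decomposable A
      & isomorphic G (subgroup (torsion G) * A)%type].
Proof.
move=> /direct_summand_projections[K [prT [prK [sumE prTT prKT prKK prTK]]]].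
move=> [S [H [spS /direct_summand_projections[L [prH [_ [_ prHH _ _ _]]]] [e [e' eK e'K]]]]].
have tfK : torsion_free (subgroup K).
  move=> x n n0 xn.
  have xT : val x \in torsion G.
    by rewrite inE; exists n => //; rewrite -raddfMn xn raddf0.
  by rewrite -(prKK x) -[val x]/(val (Subgroup xT)) prKT.
exists (subgroup K); split=> //.
  have [Q [I [rho [b [j [tfQ dec jsurj jker]]]]]] := simply_presented_modulo_torsion spS.
  have e'B : zmod_morphism e' by move=> x y; apply: (can_inj eK); rewrite raddfB !e'K.
  have [d dE] := ex_additive e'B.
  pose inc : {additive subgroup K -> S} := \val \o (e \o \val).
  pose ret : {additive S -> subgroup K} := prK \o (d \o prH).
  have retK k : ret (inc k) = k by rewrite /ret /inc /= prHH dE eK prKK.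
  have retj x : j x = 0 -> ret x = 0.
    by move=> /jker[n n0 xn]; apply: (tfK _ n n0); rewrite -raddfMn xn raddf0.
  have [ret' ret'E] := factor_additive jsurj retj.
  apply: (completely_decomposable_retract (inc := j \o inc) (ret := ret') tfQ dec).
  by move=> k /=; rewrite ret'E retK.
have fB : zmod_morphism (fun x => (prT x, prK x)).
  by move=> x y; rewrite !raddfB.
have [f fE] := ex_additive fB; exists f.
exists (fun tk => val tk.1 + val tk.2) => [x|[t k]] /=; first by rewrite fE sumE.
by rewrite fE !raddfD prTT prTK prKT prKK addr0 add0r.
Qed.

Theorem proposition2p5 (G : zmodType) (hG : bounded_p_torsion G) :
  [<-> balanced_projective G;
       splitting_mixed G /\ warfield G;
       exists A : zmodType,
         [/\ torsion_free A, completely_decomposable A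
           & isomorphic G (subgroup (torsion G) * A)%type]].
Proof.
tfae.
- move=> projG; split; first exact: splitting_of_balanced_projective.
  exact: warfield_of_balanced_projective.
- by move=> [splitG warG]; apply: decomposable_of_splitting_warfield.
- by move=> [A [tfA cdA isoA]]; apply: balanced_projective_of_splitting isoA.
Qed.
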